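(* Let $\alpha,\beta$ be real constants with $0\le\beta<2^{-H(\alpha)/\alpha}<\alpha\le1$. Then there exist a rational number $c$ with $0<c<\alpha$ and a constant $C>0$ such that for every $\varepsilon\in(0,1/2]$, every integer $n\ge C\log(1/\varepsilon)$, and every two-outcome verifier $P_0,P_1$ (for any $r$ and any spaces) with single-copy optimal winning probability $p$: if $p\ge\alpha$ then $p'_{n,\lfloor cn\rfloor}\ge1-\varepsilon$, and if $p\le\beta$ then $p'_{n,\lfloor cn\rfloor}\le\varepsilon$. That is, repeating the interaction $n=O(\log(1/\varepsilon))$ times in parallel and accepting iff at least $\lfloor cn\rfloor$ copies accept reduces both the completeness error and the soundness error below $\varepsilon$.
   Context: $H(x)=-x\log_2x-(1-x)\log_2(1-x)$ is the binary entropy (with $H(1)=0$). Fix an integer $r\ge1$ and finite-dimensional complex Hilbert spaces $\mathcal{X}_1,\dots,\mathcal{X}_r$, $\mathcal{Y}_1,\dots,\mathcal{Y}_r$; write $\mathcal{X}_{1\ldots j}=\mathcal{X}_1\otimes\cdots\otimes\mathcal{X}_j$, similarly $\mathcal{Y}_{1\ldots j}$, identifying tensor products in different orders. $\mathrm{Pos}$ = positive semidefinite operators, $\mathrm{D}$ = density operators, $\langle A,B\rangle=\mathrm{Tr}(A^*B)$. A two-outcome verifier (modelling a quantum interactive proof verifier on a fixed input, outcome $1$ = accept) is a pair $P_0,P_1\in\mathrm{Pos}(\mathcal{Y}_{1\ldots r}\otimes\mathcal{X}_{1\ldots r})$ for which there exist $R_1=\rho\in\mathrm{D}(\mathcal{X}_1)$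 and $R_j\in\mathrm{Pos}(\mathcal{Y}_{1\ldots j-1}\otimes\mathcal{X}_{1\ldots j})$, $2\le j\le r$, with $\mathrm{Tr}_{\mathcal{X}_{j+1}}(R_{j+1})=\mathbb{I}_{\mathcal{Y}_j}\otimes R_j$ for $1\le j\le r-1$ and $P_0+P_1=\mathbb{I}_{\mathcal{Y}_r}\otimes R_r$. For $n\ge1$, an $n$-fold prover strategy is $X\in\mathrm{Pos}((\mathcal{Y}_{1\ldots r}\otimes\mathcal{X}_{1\ldots r})^{\otimes n})$ such that there exist $X_j\in\mathrm{Pos}(\mathcal{Y}_{1\ldots j}^{\otimes n}\otimes\mathcal{X}_{1\ldots j}^{\otimes n})$, $1\le j\le r$, with $X_r=X$, $\mathrm{Tr}_{\mathcal{Y}_1^{\otimes n}}(X_1)=\mathbb{I}_{\mathcal{X}_1^{\otimes n}}$, $\mathrm{Tr}_{\mathcal{Y}_j^{\otimes n}}(X_j)=X_{j-1}\otimes\mathbb{I}_{\mathcal{X}_j^{\otimes n}}$ for $2\le j\le r$. With $\Sigma^n_{\ge k}$ the strings in $\{0,1\}^n$ with at least $k$ ones, let $p=\sup\{\langle P_1,X\rangle: X \text{ a 1-fold strategy}\}$ and $p'_{n,k}=\sup\{\sum_{(i_1,\dots,i_n)\in\Sigma^n_{\ge k}}\langle P_{i_1}\otimes\cdots\otimes P_{i_n},X\rangle: X \text{ an } n\text{-fold strategy}\}$. *)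

(* Defs.v *)
From HB Require Import structures.
From mathcomp Require Import all_boot all_order all_algebra.
From mathcomp Require Import boolp classical_sets reals exp.
From mathcomp Require Import complex.

Set Implicit Arguments.
Unset Strict Implicit.
Unset Printing Implicit Defensive.

Import Order.TTheory GRing.Theory Num.Theory.
Local Open Scope ring_scope.

(* Binary entropy (base-2 logarithms); ln 0 = 0 in MathComp-Analysis, *)
(* and the terms x*log2 x with x = 0 vanish anyway, so H 1 = 0.        *)
Definition log2 {R : realType} (x : R) : R := ln x / ln 2.
Definition binH {R : realType} (x : R) : R :=
  - x * log2 x - (1 - x) * log2 (1 - x).

(* Finite-dimensional Hilbert spaces are C^B for a finite basis B.     *)
(* A family of registers is B : nat -> finType (register k is the k-th *)
(* space, 0-based: register k is the paper's X_{k+1} / Y_{k+1}).       *)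
(* The composite register 1..j has basis tup B j.                      *)
Definition tup (B : nat -> finType) (j : nat) : finType :=
  {dffun forall k : 'I_j, B k}.

Definition initt (B : nat -> finType) (j : nat) (t : tup B j.+1) : tup B j :=
  @finfun _ (fun k : 'I_j => B k) (fun k => t (widen_ord (leqnSn j) k)).
Definition lastt (B : nat -> finType) (j : nat) (t : tup B j.+1) : B j :=
  t ord_max.

(* n copies of each register: register k of the n-fold system is       *)
(* X_k^{(x) n}, with basis {ffun 'I_n -> B k}.                          *)
Definition copies (n : nat) (B : nat -> finType) : nat -> finType :=
  fun k => {ffun 'I_n -> B k}.

Definition proj_copy (n : nat) (B : nat -> finType) (j : nat) (i : 'I_n)
  (t : tup (copies n B) j) : tup B j :=
  @finfun _ (fun k : 'I_j => B k) (fun k => t k i).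

Section Ops.
Variable R : realType.
Local Notation C := R[i].

(* linear operators on C^T, as matrices indexed by T *)
Definition Op (T : finType) := T -> T -> C.

Definition psd (T : finType) (A : Op T) : Prop :=
  forall v : T -> C, 0 <= \sum_(a : T) \sum_(b : T) (v a)^* * A a b * v b.

Definition trace (T : finType) (A : Op T) : C := \sum_(a : T) A a a.

Definition density (T : finType) (A : Op T) : Prop := psd A /\ trace A = 1.

Definition hs (T : finType) (A B : Op T) : C :=
  \sum_(a : T) \sum_(b : T) (A a b)^* * B a b.

Variables (BY BX : nat -> finType).

Definition ptrX (jy jx : nat) (A : Op (tup BY jy * tup BX jx.+1)%type) :
    Op (tup BY jy * tup BX jx)%type :=
  fun a b => \sum_(u : tup BX jx.+1 | initt u == a.2)
             \sum_(v : tup BX jx.+1 | (initt v == b.2) && (lastt v == lastt u))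
               A (a.1, u) (b.1, v).

Definition ptrY (jy jx : nat) (A : Op (tup BY jy.+1 * tup BX jx)%type) :
    Op (tup BY jy * tup BX jx)%type :=
  fun a b => \sum_(u : tup BY jy.+1 | initt u == a.1)
             \sum_(v : tup BY jy.+1 | (initt v == b.1) && (lastt v == lastt u))
               A (u, a.2) (v, b.2).

Definition tensIY (jy jx : nat) (A : Op (tup BY jy * tup BX jx)%type) :
    Op (tup BY jy.+1 * tup BX jx)%type :=
  fun a b => (lastt a.1 == lastt b.1)%:R * A (initt a.1, a.2) (initt b.1, b.2).

Definition tensIX (jy jx : nat) (A : Op (tup BY jy * tup BX jx)%type) :
    Op (tup BY jy * tup BX jx.+1)%type :=
  fun a b => (lastt a.2 == lastt b.2)%:R * A (a.1, initt a.2) (b.1, initt b.2).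

(* A two-outcome verifier with r = r'.+1 rounds.
   R j (0 <= j <= r') is the paper's R_{j+1}, an operator on
   Y_{1..j} (x) X_{1..j+1}; R 0 = rho (Y_{1..0} is trivial). *)
Definition verifier (r' : nat) (P0 P1 : Op (tup BY r'.+1 * tup BX r'.+1)%type) : Prop :=
  exists Rs : forall j : nat, Op (tup BY j * tup BX j.+1)%type,
    [/\ density (Rs 0%N),
        (forall j, (j <= r')%N -> psd (Rs j)),
        (forall j, (j < r')%N -> ptrX (Rs j.+1) = tensIY (Rs j)),
        psd P0 /\ psd P1 &
        (fun a b => P0 a b + P1 a b) = tensIY (Rs r')].

(* A prover strategy with r = r'.+1 rounds.
   Xs j (0 <= j <= r') is the paper's X_{j+1}, an operator on
   Y_{1..j+1} (x) X_{1..j+1}. *)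
Definition strategy (r' : nat) (X : Op (tup BY r'.+1 * tup BX r'.+1)%type) : Prop :=
  exists Xs : forall j : nat, Op (tup BY j.+1 * tup BX j.+1)%type,
    [/\ (forall j, (j <= r')%N -> psd (Xs j)),
        ptrY (Xs 0%N) = (fun a b => (a == b)%:R),
        (forall j, (j < r')%N -> ptrY (Xs j.+1) = tensIX (Xs j)) &
        Xs r' = X].

End Ops.

Section Values.
Variable R : realType.

(* P_{s_1} (x) ... (x) P_{s_n}, written in the basis of
   Y_{1..r}^{(x)n} (x) X_{1..r}^{(x)n} (tensor factors reordered). *)
Definition tensP (BY BX : nat -> finType) (r n : nat)
  (P : bool -> Op R (tup BY r * tup BX r)%type) (s : {ffun 'I_n -> bool}) :
  Op R (tup (copies n BY) r * tup (copies n BX) r)%type :=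
  fun a b => \prod_(i < n) P (s i) (proj_copy i a.1, proj_copy i a.2)
                                    (proj_copy i b.1, proj_copy i b.2).

Definition Pof (T : finType) (P0 P1 : Op R T) (o : bool) : Op R T :=
  if o then P1 else P0.

(* p = sup { <P_1, X> : X a 1-fold strategy }  (<P_1,X> is real for
   positive semidefinite P_1, X; we take its real part) *)
Definition pval (BY BX : nat -> finType) (r' : nat)
  (P1 : Op R (tup BY r'.+1 * tup BX r'.+1)%type) : R :=
  sup [set complex.Re (hs P1 X) | X in [set X | @strategy R BY BX r' X]].

Definition pval_n (BY BX : nat -> finType) (r' : nat)
  (P0 P1 : Op R (tup BY r'.+1 * tup BX r'.+1)%type) (n : nat) (k : int) : R :=
  sup [set complex.Re (\sum_(s : {ffun 'I_n -> bool} | k <= (#|[pred i | s i]|)%:Z)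
                         hs (tensP (Pof P0 P1) s) X)
      | X in [set X | @strategy R (copies n BY) (copies n BX) r' X]].

End Values.

(* Main.v *)
Require Import Defs.
From HB Require Import structures.
From mathcomp Require Import all_boot all_order all_algebra.
From mathcomp Require Import boolp classical_sets reals sequences exp.
From mathcomp Require Import complex.
From mathcomp Require Import ring lra.
Import Order.TTheory GRing.Theory Num.Theory.
Local Open Scope ring_scope.
Set Implicit Arguments.
Unset Strict Implicit.
Unset Printing Implicit Defensive.

(** A feasible point of value [l] for the semidefinite programme dual to
    "maximise <Z, X> over strategies X" is a chain of operators Q_1, ..., Q_r
    with [Z <= I (x) Q_r], [Tr Q_(j+1) <= I (x) Q_j] and [Tr Q_1 = l]. Such
    chains can be added and tensored. The verifier itself is one of value 1 for
    P_0 + P_1 and, by strong duality, P_1 has one of value [l] for every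
    [l > p]. Hence P_0 + u P_1 = (P_0 + P_1) + (u - 1) P_1 has one of value
    1 + (u - 1) l for every [u >= 1], and tensoring yields
    E[u^(number of accepting copies)] <= (1 + (u - 1) l)^n for every n-fold
    strategy, however correlated: the moment bound of independent copies. By
    Chernoff's argument any rational c strictly between beta and alpha is a
    sound threshold, and it is complete by the lower tail for independent
    copies of a nearly optimal strategy.

    Strong duality holds since the dual value is a finite sublinear function of
    Z, hence, by the Hahn-Banach theorem, is supported at P_1 by a linear form;
    every operator representing such a form is a strategy. *)

(** * Positive semidefinite operators *)

Section Operators.
Variable R : realType.
Local Notation C := R[i].

Definition qform (T : finType) (A : Op R T) (v : T -> C) : C :=
  \sum_a \sum_b (v a)^* * A a b * v b.

Lemma sum_delta (T : finType) (a : T) (F : T -> C) :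
  \sum_b (b == a)%:R * F b = F a.
Proof.
rewrite (bigD1 a) //= eqxx mul1r big1 ?addr0 // => b /negbTE ->.
by rewrite mul0r.
Qed.

Lemma qform_delta2 (T : finType) (A : Op R T) (a b : T) (s t : C) :
  qform A (fun x => (x == a)%:R * s + (x == b)%:R * t) =
  s^* * A a a * s + s^* * A a b * t + t^* * A b a * s + t^* * A b b * t.
Proof.
have sum2 (F : T -> C) (x y : C) :
    \sum_c F c * ((c == a)%:R * x + (c == b)%:R * y) = F a * x + F b * y.
  under eq_bigr => c _ do rewrite mulrDr [_ * (_ * x)]mulrCA [_ * (_ * y)]mulrCA.
  by rewrite big_split /= !sum_delta.
rewrite /qform.
under eq_bigr => c _ do rewrite sum2 -!mulrA -mulrDr rmorphD !rmorphM !rmorph_nat mulrC.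
by rewrite sum2; ring.
Qed.

(** Being at least 0 in the complex order includes being real, so polarisation at e_a + e_b and e_a
    + i e_b makes [A a b + A b a] and ['i * (A a b - A b a)] real. *)
Lemma psd_herm (T : finType) (A : Op R T) (a b : T) :
  psd A -> A b a = (A a b)^*.
Proof.
move=> psdA.
have q s t : 0 <= qform A (fun x => (x == a)%:R * s + (x == b)%:R * t).
  exact: psdA.
have Aaa : A a a \is Num.real.
  by have := q 1 0; rewrite qform_delta2 conjC0 conjC1 !(mul0r, mul1r, mulr1, mulr0,
    addr0) => /ger0_real.
have Abb : A b b \is Num.real.
  by have := q 0 1; rewrite qform_delta2 conjC0 conjC1 !(mul0r, mul1r, mulr1, mulr0,
    add0r) => /ger0_real.
have h1 : A a b + A b a \is Num.real.
  have /ger0_real := q 1 1; rewrite qform_delta2 conjC1 !(mul1r, mulr1).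
  have -> : A a a + A a b + A b a + A b b = (A a a + A b b) + (A a b + A b a) by ring.
  by rewrite rpredDl // rpredD.
have h2 : 'i * (A a b - A b a) \is Num.real.
  have /ger0_real := q 1 'i; rewrite qform_delta2 conjC1 conjCi !(mul1r, mulr1).
  have -> : A a a + A a b * 'i + - 'i * A b a + - 'i * A b b * 'i
     = (A a a - 'i ^+ 2 * A b b) + 'i * (A a b - A b a) by ring.
  by rewrite sqrCi mulN1r opprK rpredDl // rpredD.
have e1 := CrealP h1; have := CrealP h2.
rewrite rmorphM /= conjCi rmorphB /= mulNr -mulrN => /(mulfI (neq0Ci _)).
rewrite opprB => e2; rewrite rmorphD /= in e1.
have n2 : (2 : C) != 0 by rewrite pnatr_eq0.
apply: (mulfI n2).
set x := A a b in e1 e2 *; set y := A b a in e1 e2 *.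
by transitivity ((x + y) - (x - y)); [ring | rewrite -e1 -e2; ring].
Qed.

(** Spectral theorem: [V k] is an eigenvector scaled by the square root of its eigenvalue. *)
Lemma psd_gram (T : finType) (A : Op R T) : psd A ->
  exists V : 'I_#|T| -> T -> C, forall a b, A a b = \sum_k V k a * (V k b)^*.
Proof.
move=> psdA; pose M : 'M[C]_#|T| := \matrix_(i, j) A (enum_val i) (enum_val j).
have Mherm : M \is hermsymmx.
  apply/is_hermitianmxP; rewrite expr0 scale1r; apply/matrixP => i j.
  by rewrite !mxE; exact: psd_herm.
have /hermitian_normalmx /orthomx_spectralP := Mherm.
set P := spectralmx M; set d := spectral_diag M => Meq.
have PU : P \is unitarymx := spectral_unitarymx M.
(* Each eigenvalue is a value of the quadratic form, hence nonnegative. *)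
have dE k : d 0 k = qform A (fun a => (P k (enum_rank a))^*).
  have : P *m M *m invmx P = diag_mx d.
    by rewrite Meq !mulmxA mulmxV ?unitarymx_unit // mul1mx mulmxK ?unitarymx_unit.
  rewrite invmx_unitary // => /matrixP /(_ k k); rewrite [RHS]mxE eqxx mulr1n => <-.
  have sumE (F : T -> C) : \sum_a F a = \sum_(i < #|T|) F (enum_val i).
    by rewrite -big_enum_val; apply: eq_bigl => a; rewrite inE.
  rewrite mxE /qform exchange_big /= sumE; apply: eq_bigr => j _.
  rewrite !mxE mulr_suml sumE; apply: eq_bigr => i _.
  by rewrite !mxE !enum_valK conjCK.
have d_ge0 k : 0 <= d 0 k by rewrite dE; exact: psdA.
exists (fun k a => (P k (enum_rank a))^* * sqrtC (d 0 k)) => a b.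
have := congr1 (fun N : 'M_#|T| => N (enum_rank a) (enum_rank b)) Meq.
rewrite !mxE !enum_rankK => ->; apply: eq_bigr => k _.
rewrite invmx_unitary // mul_mx_diag !mxE /= rmorphM /= conjCK.
have -> : (sqrtC (d 0 k))^* = sqrtC (d 0 k) by apply/conj_Creal/ger0_real;
  rewrite sqrtC_ge0.
by rewrite -[in LHS](sqrtCK (d 0 k)); ring.
Qed.

Lemma gram_psd (I T : finType) (A : Op R T) (V : I -> T -> C) :
  (forall a b, A a b = \sum_k V k a * (V k b)^*) -> psd A.
Proof.
move=> AE v.
have -> : \sum_a \sum_b (v a)^* * A a b * v b =
   \sum_k `|\sum_a (v a)^* * V k a| ^+ 2.
  transitivity (\sum_a \sum_b \sum_k ((v a)^* * V k a) * (v b * (V k b)^*)).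
    apply: eq_bigr => a _; apply: eq_bigr => b _.
    rewrite AE mulr_sumr mulr_suml; apply: eq_bigr => k _.
    by rewrite !mulrA -[_ * v b]mulrA [_^* * v b]mulrC !mulrA mulrAC.
  under eq_bigr => a _ do rewrite exchange_big.
  rewrite exchange_big; apply: eq_bigr => k _.
  rewrite normCK rmorph_sum mulr_suml; apply: eq_bigr => a _.
  rewrite mulr_sumr; apply: eq_bigr => b _.
  by rewrite rmorphM /= conjCK.
by apply: sumr_ge0 => k _; rewrite exprn_ge0.
Qed.

(** Entrywise products of Gram matrices are Gram matrices, with vectors indexed by choice functions
    [f]. When [p i] reads off the [i]-th factor, this is positivity of tensor products. *)
Lemma psd_prod (I S T : finType) (A : I -> Op R T) (p : I -> S -> T) :
  (forall i, psd (A i)) -> psd (fun a b : S => \prod_i A i (p i a) (p i b)).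
Proof.
move=> psdA.
have [V VE] : exists V : I -> 'I_#|T| -> T -> C,
    forall i a b, A i a b = \sum_k V i k a * (V i k b)^*.
  by have /choice[V VE] := fun i => psd_gram (psdA i); exists V.
apply: (@gram_psd {ffun I -> 'I_#|T|} _ _ (fun f a => \prod_i V i (f i) (p i a))) => a b.
under eq_bigr => i _ do rewrite VE.
rewrite bigA_distr_bigA; apply: eq_bigr => f _.
by rewrite rmorph_prod -big_split.
Qed.

(** With Gram vectors [V k] of [A], the pairing is the sum of the values of the quadratic form of
    [B] at the [V k]. *)
Lemma hs_psd_ge0 (T : finType) (A B : Op R T) : psd A -> psd B -> 0 <= hs A B.
Proof.
move=> /psd_gram[V VE] psdB.
have -> : hs A B = \sum_k qform B (V k).
  rewrite /hs exchange_big /= /qform [RHS]exchange_big /= exchange_big /=.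
  apply: eq_bigr => a _; rewrite exchange_big; apply: eq_bigr => b _.
  rewrite VE rmorph_sum mulr_suml; apply: eq_bigr => k _.
  by rewrite rmorphM /= conjCK -!mulrA [V k b * _]mulrC.
by apply: sumr_ge0 => k _; exact: psdB.
Qed.

Lemma hs_conj (T : finType) (A B : Op R T) : hs A B = (hs B A)^*.
Proof.
rewrite /hs rmorph_sum; apply: eq_bigr => a _.
rewrite rmorph_sum; apply: eq_bigr => b _.
by rewrite rmorphM /= conjCK mulrC.
Qed.

End Operators.

(** * Partial traces *)

(* [bipartition S T Z] identifies C^S with C^T (x) C^Z. *)
Record bipartition (S T Z : finType) := Bipartition {
  join : T -> Z -> S;
  front : S -> T;
  back : S -> Z;
  front_join : forall t z, front (join t z) = t;
  back_join : forall t z, back (join t z) = z;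
  join_split : forall s, join (front s) (back s) = s }.

Section Bipartition.
Variable R : realType.
Local Notation C := R[i].
Variables (S T Z : finType) (sp : bipartition S T Z).

Definition ptr (A : Op R S) : Op R T :=
  fun a b => \sum_z A (join sp a z) (join sp b z).

Definition tensI (A : Op R T) : Op R S :=
  fun a b => (back sp a == back sp b)%:R * A (front sp a) (front sp b).

Lemma big_split_join (F : S -> C) : \sum_s F s = \sum_t \sum_z F (join sp t z).
Proof.
rewrite pair_big (reindex (fun p : T * Z => join sp p.1 p.2)) //=.
exists (fun s => (front sp s, back sp s)) => [[t z] _|s _] /=.
  by rewrite front_join back_join.
exact: join_split.
Qed.

Lemma tensI_join (A : Op R T) t z t' z' :
  tensI A (join sp t z) (join sp t' z') = (z == z')%:R * A t t'.
Proof. by rewrite /tensI !back_join !front_join. Qed.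

Lemma big_split_diag (F : T -> T -> C) (G : T -> Z -> T -> Z -> C) :
  \sum_t \sum_z \sum_t' \sum_z' (z == z')%:R * F t t' * G t z t' z' =
  \sum_t \sum_t' F t t' * \sum_z G t z t' z.
Proof.
apply: eq_bigr => t _; rewrite exchange_big; apply: eq_bigr => t' _.
rewrite mulr_sumr; apply: eq_bigr => z _.
rewrite (bigD1 z) //= eqxx mul1r big1 ?addr0 // => z' zz'.
by rewrite eq_sym (negbTE zz') !mul0r.
Qed.

Lemma hs_tensIl (Q : Op R T) (A : Op R S) : hs (tensI Q) A = hs Q (ptr A).
Proof.
rewrite /hs big_split_join.
rewrite -[RHS](big_split_diag (fun t t' => (Q t t')^*)
  (fun t z t' z' => A (join sp t z) (join sp t' z'))).
apply: eq_bigr => t _; apply: eq_bigr => z _; rewrite big_split_join.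
apply: eq_bigr => t' _; apply: eq_bigr => z' _.
by rewrite tensI_join rmorphM rmorph_nat.
Qed.

Lemma hs_tensIr (A : Op R S) (Q : Op R T) : hs A (tensI Q) = hs (ptr A) Q.
Proof. by rewrite hs_conj hs_tensIl -hs_conj. Qed.

(** The vectors on the right are v (x) e_z; hence positivity passes to partial traces. *)
Lemma qform_ptr (A : Op R S) (v : T -> C) :
  qform (ptr A) v = \sum_z qform A (fun s => (back sp s == z)%:R * v (front sp s)).
Proof.
rewrite /qform /ptr; symmetry.
transitivity (\sum_z \sum_t \sum_t' (v t)^* * A (join sp t z) (join sp t' z) * v t').
  apply: eq_bigr => z _; rewrite big_split_join; apply: eq_bigr => t _.
  rewrite (bigD1 z) //= back_join eqxx front_join mul1r [X in _ + X]big1 ?addr0;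
    last first.
    move=> z' zz'; rewrite big1 // => s _.
    by rewrite back_join (negbTE zz') mul0r conjC0 !mul0r.
  rewrite big_split_join; apply: eq_bigr => t' _.
  rewrite (bigD1 z) //= back_join eqxx front_join mul1r big1 ?addr0 // => z' zz'.
  by rewrite back_join (negbTE zz') mul0r mulr0.
rewrite exchange_big; apply: eq_bigr => t _; rewrite exchange_big; apply: eq_bigr => t' _.
by rewrite mulr_sumr mulr_suml.
Qed.

(** On vectors v (x) e_z the operator I (x) Q acts as Q, so a basis vector [z] lets positivity
    descend from [tensI] to its factor. *)
Lemma qform_tensI (Q : Op R T) (z : Z) (v : T -> C) :
  qform (tensI Q) (fun s => (back sp s == z)%:R * v (front sp s)) = qform Q v.
Proof.
rewrite /qform big_split_join; apply: eq_bigr => t _.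
rewrite (bigD1 z) //= [X in _ + X]big1 ?addr0; last first.
  move=> z' zz'; rewrite big1 // => s _.
  by rewrite back_join (negbTE zz') mul0r conjC0 !mul0r.
rewrite big_split_join; apply: eq_bigr => t' _.
rewrite (bigD1 z) //= big1 ?addr0; last first.
  by move=> z' zz'; rewrite !back_join (negbTE zz') mul0r mulr0.
by rewrite tensI_join !back_join !front_join eqxx !mul1r.
Qed.

Lemma psd_ptr (A : Op R S) : psd A -> psd (ptr A).
Proof.
move=> psdA v; rewrite -/(qform _ _) qform_ptr.
by apply: sumr_ge0 => z _; exact: psdA.
Qed.

Lemma ptr_tensI (Q : Op R T) : ptr (tensI Q) = fun a b => #|Z|%:R * Q a b.
Proof.
apply/funext => a; apply/funext => b; rewrite /ptr.
under eq_bigr => z _ do rewrite tensI_join eqxx mul1r.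
by rewrite sumr_const mulr_natl.
Qed.

Lemma tensI1 : tensI (fun a b => (a == b)%:R) = (fun a b => (a == b)%:R).
Proof.
apply/funext => a; apply/funext => b; rewrite /tensI -natrM mulnb; congr (_%:R).
congr nat_of_bool; apply/andP/eqP => [[/eqP e1 /eqP e2]|->]; last by rewrite !eqxx.
by rewrite -(join_split sp a) e1 e2 join_split.
Qed.

End Bipartition.

(* The [i]-th factor acts on the image of [p i]. *)
Definition tens (R : realType) (I S T : finType) (p : I -> S -> T)
  (A : I -> Op R T) : Op R S := fun a b => \prod_i A i (p i a) (p i b).

(** * Tensor products against partial traces and identity factors *)

Section TensorSplit.
Variable R : realType.
Local Notation C := R[i].
Variables (I S T Z S' T' : finType) (sp : bipartition S T Z).
Variable (sp' : bipartition S' T' {ffun I -> Z}).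
Variables (pS : I -> S' -> S) (pT : I -> T' -> T).
Hypothesis pS_join : forall i t z, pS i (join sp' t z) = join sp (pT i t) (z i).

Lemma proj_front i s : front sp (pS i s) = pT i (front sp' s).
Proof. by rewrite -{1}(join_split sp' s) pS_join front_join. Qed.

Lemma proj_back i s : back sp (pS i s) = back sp' s i.
Proof. by rewrite -{1}(join_split sp' s) pS_join back_join. Qed.

(** Tracing out a product register sums over functions, and a product of sums distributes into such
    a sum. *)
Lemma tens_ptr (A : I -> Op R S) :
  tens pT (fun i => ptr sp (A i)) = ptr sp' (tens pS A).
Proof.
apply/funext => a; apply/funext => b; rewrite /tens /ptr bigA_distr_bigA.
apply: eq_bigr => f _; apply: eq_bigr => i _.
by rewrite !pS_join.
Qed.

(** The identity on the product register is a product of Kronecker deltas, as functions are equal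
    iff they agree at every [i]. *)
Lemma tens_tensI (Q : I -> Op R T) :
  tens pS (fun i => tensI sp (Q i)) = tensI sp' (tens pT Q).
Proof.
apply/funext => a; apply/funext => b; rewrite /tens /tensI big_split /=.
congr (_ * _); last by apply: eq_bigr => i _; rewrite !proj_front.
case: eqP => [e|ne].
  by rewrite big1 // => i _; rewrite !proj_back e eqxx.
have [i ni] : exists i, back sp' a i != back sp' b i.
  apply: contrapT => h; apply: ne; apply/ffunP => i; apply/eqP/negPn/negP => ni.
  by apply: h; exists i.
by rewrite (bigD1 i) //= !proj_back (negbTE ni) mul0r.
Qed.

End TensorSplit.

(** * Registers *)

Lemma ord_eq_last j (k : 'I_j.+1) : ~ (k < j)%N -> j = k.
Proof. by move=> /negP kj; apply/eqP; rewrite eqn_leq leqNgt kj -ltnS ltn_ord. Qed.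

Section Registers.
Variable B : nat -> finType.

(** The type of an entry depends on its index, so the last entry is transported along a proof of
    [j = k]; [decP] exposes the proofs in both cases. *)
Definition snoc j (t : tup B j) (x : B j) : tup B j.+1 :=
  @finfun _ (fun k : 'I_j.+1 => B k) (fun k : 'I_j.+1 =>
    match decP (@idP (k < j)%N) with
    | left h => t (Ordinal h)
    | right h => eq_rect j (fun n => B n) x k (ord_eq_last h)
    end).

Lemma initt_snoc j (t : tup B j) x : initt (snoc t x) = t.
Proof.
apply/ffunP => k; rewrite /initt /snoc !ffunE.
case: (decP _) => [h|h]; last by exfalso; apply: h; exact: (ltn_ord k).
by case: k h => k kj h; rewrite (bool_irrelevance h kj).
Qed.

Lemma lastt_snoc j (t : tup B j) x : lastt (snoc t x) = x.
Proof.
rewrite /lastt /snoc ffunE; case: (decP _) => [h|h]; first by exfalso;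
  rewrite /= ltnn in h.
(* The transport is along an equality of [j] with itself, hence trivial by uniqueness of such
   proofs. *)
by rewrite (eq_irrelevance (ord_eq_last h) erefl).
Qed.

Lemma snoc_initt j (t : tup B j.+1) : snoc (initt t) (lastt t) = t.
Proof.
apply/ffunP => k; rewrite ffunE; case: (decP _) => [h|h].
  by rewrite /initt ffunE; case: k h => k kj h;
    rewrite (bool_irrelevance kj (widen_ord_proof (Ordinal h) (leqnSn j))).
move: (ord_eq_last h) => e; rewrite /lastt /ord_max.
by case: k h e => k /= kj h e; subst k; rewrite (bool_irrelevance kj (ltnSn j)).
Qed.
End Registers.

Section RegisterSplits.
Variables (BY BX : nat -> finType).

(** Kept transparent: [tensIYE] holds by conversion, and [join] must compute on projections to
    copies. *)
Definition splitY j jx :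
  bipartition (tup BY j.+1 * tup BX jx)%type (tup BY j * tup BX jx)%type (BY j).
Proof.
refine (@Bipartition _ _ _ (fun a y => (snoc a.1 y, a.2)) (fun a =>
  (initt a.1, a.2)) (fun a => lastt a.1) _ _ _).
- by move=> [a b] y /=; rewrite initt_snoc.
- by move=> [a b] y /=; rewrite lastt_snoc.
- by move=> [a b] /=; rewrite snoc_initt.
Defined.

Definition splitX jy j :
  bipartition (tup BY jy * tup BX j.+1)%type (tup BY jy * tup BX j)%type (BX j).
Proof.
refine (@Bipartition _ _ _ (fun a x => (a.1, snoc a.2 x)) (fun a =>
  (a.1, initt a.2)) (fun a => lastt a.2) _ _ _).
- by move=> [a b] y /=; rewrite initt_snoc.
- by move=> [a b] y /=; rewrite lastt_snoc.
- by move=> [a b] /=; rewrite snoc_initt.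
Defined.

Variable R : realType.

Lemma big_initt (B : nat -> finType) j (t : tup B j) (P : pred (tup B j.+1))
  (F : tup B j.+1 -> R[i]) :
  \sum_(u | (initt u == t) && P u) F u = \sum_(x | P (snoc t x)) F (snoc t x).
Proof.
rewrite (reindex_onto (snoc t) (@lastt B j)) /=; last first.
  by move=> u /andP[/eqP <- _]; rewrite snoc_initt.
by apply: eq_bigl => x; rewrite initt_snoc lastt_snoc !eqxx andbT.
Qed.

Lemma ptrYE j jx (A : Op R (tup BY j.+1 * tup BX jx)%type) :
  ptrY A = ptr (splitY j jx) A.
Proof.
apply/funext => a; apply/funext => b; rewrite /ptrY /ptr /=.
(* A vacuous conjunct brings the outer sum into the form of [big_initt]; the inner sum then has a
   single term. *)
rewrite -[LHS](eq_bigl _ _ (fun u => andbT (initt u == a.1))) big_initt.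
apply: eq_bigr => x _; rewrite big_initt lastt_snoc (big_pred1 x) // => y.
by rewrite lastt_snoc.
Qed.

Lemma ptrXE jy j (A : Op R (tup BY jy * tup BX j.+1)%type) :
  ptrX A = ptr (splitX jy j) A.
Proof.
apply/funext => a; apply/funext => b; rewrite /ptrX /ptr /=.
rewrite -[LHS](eq_bigl _ _ (fun u => andbT (initt u == a.2))) big_initt.
apply: eq_bigr => x _; rewrite big_initt lastt_snoc (big_pred1 x) // => y.
by rewrite lastt_snoc.
Qed.

Lemma tensIYE j jx (A : Op R (tup BY j * tup BX jx)%type) :
  tensIY A = tensI (splitY j jx) A.
Proof. by []. Qed.

Variable n : nat.

Definition proj_pair jy jx (i : 'I_n)
    (a : tup (copies n BY) jy * tup (copies n BX) jx) : tup BY jy * tup BX jx :=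
  (proj_copy i a.1, proj_copy i a.2).

(** This is what provides the hypothesis [pS_join], under which tensor products respect the
    splitting of registers. *)
Lemma proj_copy_snoc (B : nat -> finType) j (i : 'I_n) (t : tup (copies n B) j) x :
  proj_copy i (snoc t x) = snoc (proj_copy i t) (x i).
Proof.
apply/ffunP => k; rewrite !ffunE.
case: (decP _) => [h|h]; first by rewrite ffunE.
by move: (ord_eq_last h) => e; case: k h e => k /= kj h e; subst k.
Qed.
End RegisterSplits.

(** * Sums over the basis of the n-fold system *)

Section TensorSums.
Variables (R : realType) (BY BX : nat -> finType) (n jy jx : nat).
Local Notation T := (tup BY jy * tup BX jx)%type.
Local Notation Tn := (tup (copies n BY) jy * tup (copies n BX) jx)%type.

Definition merge_copies (B : nat -> finType) j (f : 'I_n -> tup B j) : tup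
  (copies n B) j :=
  @finfun _ (fun k : 'I_j => copies n B k) (fun k => [ffun i => f i k]).

(** After interchanging registers and copies, a basis vector of the n-fold system is a family of [n]
    single-copy basis vectors; the rest is distributivity. *)
Lemma big_copies (F : 'I_n -> T -> R[i]) :
  \sum_(a : Tn) \prod_i F i (proj_pair i a) = \prod_i \sum_(t : T) F i t.
Proof.
rewrite bigA_distr_bigA (reindex (fun f : {ffun 'I_n -> T} =>
   (merge_copies (fun i => (f i).1), merge_copies (fun i => (f i).2)))) /=.
  apply: eq_bigr => f _; apply: eq_bigr => i _; congr (F i _).
  rewrite /proj_pair /= [RHS]surjective_pairing; congr (_, _); apply/ffunP => k.
    by rewrite !ffunE.
  by rewrite !ffunE.
exists (fun a => [ffun i => proj_pair i a]) => [f _|[a b] _] /=.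
  apply/ffunP => i; rewrite ffunE /proj_pair /= [RHS]surjective_pairing.
  by congr (_, _); apply/ffunP => k; rewrite !ffunE.
by congr (_, _); apply/ffunP => k; rewrite ffunE; apply/ffunP => i; rewrite !ffunE.
Qed.

Lemma trace_tens (A : 'I_n -> Op R T) :
  trace (tens (@proj_pair BY BX n jy jx) A) = \prod_i trace (A i).
Proof. exact: (big_copies (fun i t => A i t t)). Qed.

Lemma hs_tens (A B : 'I_n -> Op R T) :
  hs (tens (@proj_pair BY BX n jy jx) A) (tens (@proj_pair BY BX n jy jx) B) =
    \prod_i hs (A i) (B i).
Proof.
rewrite /hs -big_copies; apply: eq_bigr => a _.
rewrite -(big_copies (fun i t => (A i (proj_pair i a) t)^* * B i (proj_pair i a) t)).
by apply: eq_bigr => b _; rewrite rmorph_prod -big_split.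
Qed.
End TensorSums.

(** * Separation in finite dimension *)

Section RealLinear.
Variable R : realType.
Local Notation C := R[i].
Local Notation Re := complex.Re.
Local Notation Im := complex.Im.

Lemma ReD (x y : C) : Re (x + y) = Re x + Re y.
Proof. by case: x y => a b [c d]. Qed.

Lemma Re_scale (c : R) (x : C) : Re (c%:C%C * x) = c * Re x.
Proof. by case: x => a b /=; rewrite mul0r subr0. Qed.

Lemma Re_sum (I : Type) (s : seq I) (P : pred I) (F : I -> C) :
  Re (\sum_(i <- s | P i) F i) = \sum_(i <- s | P i) Re (F i).
Proof. by elim/big_rec2: _ => [|i x y _ <-] //; rewrite ReD. Qed.

Lemma Re_conjE (x : C) : Re x^* = Re x. Proof. by case: x. Qed.

Lemma ge0_RRe (x : C) : 0 <= x -> x = (Re x)%:C%C.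
Proof. by move=> /ger0_real /RRe_real ->. Qed.

Lemma Re_ge0 (x : C) : 0 <= x -> 0 <= Re x.
Proof. by rewrite lecE => /andP[]. Qed.

Lemma Re_le (x y : C) : x <= y -> Re x <= Re y.
Proof. by rewrite lecE => /andP[]. Qed.

(* [F] plays the epigraph of a sublinear function. *)
Lemma hahn_banach_seq (V : lmodType R) (I : eqType) (e : I -> V) (s : seq I) :
  uniq s -> forall F : V -> R -> Prop,
  (forall z z' t t', F z t -> F z' t' -> F (z + z') (t + t')) ->
  (forall c z t, 0 <= c -> F z t -> F (c *: z) (c * t)) ->
  (forall z, exists t, F z t) ->
  (forall t, F 0 t -> 0 <= t) ->
  exists g : I -> R, forall c t,
    F (\sum_(i <- s) c i *: e i) t -> \sum_(i <- s) c i * g i <= t.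
Proof.
elim: s => [_ F _ _ _ F0|i s IHs /= /andP[iNs us] F FD FZ Ft F0].
  by exists (fun=> 0) => c t; rewrite !big_nil; exact: F0.
(* [y] is the value of the form at [e i]: the largest one allowed by the bounds at [e i], and
   compatible with those at [- e i]. *)
pose E := [set t | F (e i) t]%classic; pose y := inf E.
have [u Fu] := Ft (- e i).
have lbE v : F (- e i) v -> lbound E (- v).
  by move=> Fv t Et; rewrite -subr_ge0 opprK; apply: F0; rewrite -(subrr (e i));
    exact: FD.
have yle t : F (e i) t -> y <= t.
  by move=> Et; apply: ge_inf => //; exists (- u); exact: lbE.
have ley v : F (- e i) v -> - v <= y.
  by move=> Fv; apply: lb_le_inf; [have [t ?] := Ft (e i); exists t | exact: lbE].
(* Epigraph of the infimum over [a] of F(z + a e_i) - a y, again sublinear; the choice of [y] keeps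
   it nonnegative at 0. *)
pose G z t := exists a : R, F (z + a *: e i) (t + a * y).
have [|||| g gP] := IHs us G.
- move=> z z' t t' [a Fa] [a' Fa']; exists (a + a').
  by rewrite scalerDl mulrDl addrACA [t + t' + _]addrACA; exact: FD.
- move=> c z t c0 [a Fa]; exists (c * a).
  by rewrite -scalerA -mulrA -scalerDr -mulrDr; exact: FZ.
- by move=> z; have [t ?] := Ft z; exists t, 0; rewrite scale0r mul0r !addr0.
- move=> t [a]; rewrite add0r => Fa.
  (* Dividing by the modulus of [a] leaves one of the two bounds on [y]. *)
  case: (ltgtP a 0) => [a0|a0|a0].
  + have a1 : 0 < - a^-1 by rewrite oppr_gt0 invr_lt0.
    have := FZ _ _ _ (ltW a1) Fa; rewrite scalerA mulNr mulVf ?lt_eqF // scaleN1r => /ley.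
    rewrite mulNr opprK mulrDr mulKf ?lt_eqF // => h.
    have : a^-1 * t <= 0 by lra.
    by rewrite nmulr_rle0 // invr_lt0.
  + have a1 : 0 < a^-1 by rewrite invr_gt0.
    have := FZ _ _ _ (ltW a1) Fa; rewrite scalerA mulVf ?gt_eqF // scale1r => /yle.
    rewrite mulrDr mulKf ?gt_eqF // => h.
    have : 0 <= a^-1 * t by lra.
    by rewrite pmulr_rge0.
  + by move: Fa; rewrite a0 scale0r mul0r addr0; exact: F0.
exists (fun j => if j == i then y else g j) => c t; rewrite !big_cons eqxx => Fc.
have -> : \sum_(j <- s) c j * (if j == i then y else g j) = \sum_(j <- s) c j * g j.
  apply: eq_big_seq => j js; case: eqP => // ji.
  by rewrite -ji js in iNs.
rewrite addrC -lerBrDr; apply: gP; exists (c i).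
by rewrite addrC subrK.
Qed.

Definition addop (T : finType) (A B : Op R T) : Op R T := fun a b => A a b + B a b.
Definition scaleop (T : finType) (c : C) (A : Op R T) : Op R T := fun a b => c * A a b.
Definition subop (T : finType) (A B : Op R T) : Op R T := fun a b => A a b - B a b.
Definition adjop (T : finType) (A : Op R T) : Op R T := fun a b => (A b a)^*.
Definition op0 (T : finType) : Op R T := fun _ _ => 0.
Definition op1 (T : finType) : Op R T := fun a b => (a == b)%:R.

(** Hahn-Banach is applied to the infimum over s >= 0 of F(Z + s P) - s m. Taking s = 0 gives
    domination by [F], and s = 1 at -P gives the lower bound [m] at [P]. *)
Lemma separating_op (T : finType) (F : Op R T -> R -> Prop) (P : Op R T) (m : R) :
  (forall A B t u, F A t -> F B u -> F (addop A B) (t + u)) ->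
  (forall (c : R) A t, 0 <= c -> F A t -> F (scaleop c%:C%C A) (c * t)) ->
  (forall A, exists t, F A t) ->
  (forall t, F (@op0 T) t -> 0 <= t) ->
  (forall t, F P t -> m <= t) ->
  exists2 X : Op R T, (forall Z t, F Z t -> Re (hs Z X) <= t) & m <= Re (hs P X).
Proof.
move=> FD FZ Ft F0 FP.
(* Operators as real coordinate vectors; the boolean index selects the imaginary part. *)
pose V := {ffun T * T * bool -> R^o}.
pose op (z : V) : Op R T := fun a b => (z (a, b, false) +i* z (a, b, true))%C.
pose G (z : V) t := exists2 s : R, 0 <= s & F (addop (op z) (scaleop s%:C%C P))
  (t + s * m).
pose e (i : T * T * bool) : V := [ffun j => (j == i)%:R].
have [|||| g gP] := @hahn_banach_seq V _ e _ (index_enum_uniq _) G.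
- move=> z z' t t' [s s0 Fs] [s' s0' Fs']; exists (s + s'); first exact: addr_ge0.
  rewrite mulrDl addrACA.
  rewrite (_ : addop _ _ =
    addop (addop (op z) (scaleop s%:C%C P)) (addop (op z') (scaleop s'%:C%C P)));
      first exact: FD.
  apply/funext => a; apply/funext => b; rewrite /addop /scaleop /op !ffunE.
  by rewrite rmorphD mulrDl addrACA.
- move=> c z t c0 [s s0 Fs]; exists (c * s); first exact: mulr_ge0.
  rewrite -mulrA -mulrDr.
  rewrite (_ : addop _ _ = scaleop c%:C%C (addop (op z) (scaleop s%:C%C P)));
    first exact: FZ.
  apply/funext => a; apply/funext => b; rewrite /addop /scaleop /op !ffunE.
  by rewrite rmorphM mulrDr mulrA; congr (_ + _); apply/eqP;
    rewrite eq_complex /= !mul0r subr0 addr0 !eqxx.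
- move=> z; have [t Fz] := Ft (op z); exists t, 0 => //.
  rewrite mul0r addr0 (_ : addop _ _ = op z) //.
  by apply/funext => a; apply/funext => b; rewrite /addop /scaleop mul0r addr0.
- move=> t [s s0]; rewrite (_ : addop _ _ = scaleop s%:C%C P); last first.
    by apply/funext => a; apply/funext => b; rewrite /addop /op !ffunE add0r.
  move: s0; rewrite le_eqVlt => /predU1P[<-|s0] Fs.
    apply: F0; move: Fs; rewrite mul0r addr0 (_ : scaleop _ _ = @op0 T) //.
    by apply/funext => a; apply/funext => b; rewrite /scaleop mul0r.
  have s1 : 0 < s^-1 by rewrite invr_gt0.
  have := FZ _ _ _ (ltW s1) Fs; rewrite (_ : scaleop _ _ = P); last first.
    apply/funext => a; apply/funext => b.
    by rewrite /scaleop mulrA -rmorphM mulVf ?gt_eqF // mul1r.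
  move=> /FP; rewrite mulrDr mulKf ?gt_eqF // => h.
  have : 0 <= s^-1 * t by lra.
  by rewrite pmulr_rge0.
(* Since [hs] conjugates its first argument, the real part of the pairing is the Euclidean product
   of coordinates, so the real linear form [g] is represented by this [X]. *)
pose X : Op R T := fun a b => (g (a, b, false) +i* g (a, b, true))%C.
pose vec (Z : Op R T) : V := [ffun p =>
  let: (a, b, c) := p in if c then Im (Z a b) else Re (Z a b)].
have opK Z : op (vec Z) = Z.
  by apply/funext => a; apply/funext => b; rewrite /op !ffunE; case: (Z a b).
have hsX Z : Re (hs Z X) = \sum_i vec Z i * g i.
  transitivity (\sum_p \sum_c vec Z (p, c) * g (p, c)); last first.
    by rewrite pair_bigA; apply: eq_bigr => -[].
  rewrite /hs Re_sum.
  under eq_bigr => a _ do rewrite Re_sum.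
  rewrite pair_bigA /=; apply: eq_bigr => -[a b] _.
  rewrite big_bool /= !ffunE /X /=; case: (Z a b) => x y /=.
  by rewrite mulNr opprK addrC.
have vecE Z : vec Z = \sum_i vec Z i *: e i.
  apply/ffunP => j; rewrite sum_ffunE (bigD1 j) //= !ffunE eqxx big1 ?addr0.
    by rewrite /GRing.scale /= mulr1.
  by move=> i ij; rewrite !ffunE eq_sym (negbTE ij) scaler0.
have GX Z t : G (vec Z) t -> Re (hs Z X) <= t by rewrite vecE hsX; exact: gP.
exists X => [Z t FZt|].
  apply: GX; exists 0 => //; rewrite opK mul0r addr0 (_ : addop _ _ = Z) //.
  by apply/funext => a; apply/funext => b; rewrite /addop /scaleop mul0r addr0.
have [u Fu] := Ft P.
have F00 : F (@op0 T) 0.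
  have := FZ 0 P u (lexx _) Fu; rewrite mul0r (_ : scaleop _ _ = @op0 T) //.
  by apply/funext => a; apply/funext => b; rewrite /scaleop mul0r.
have : Re (hs (scaleop (-1) P) X) <= - m.
  apply: GX; exists 1 => //; rewrite opK mul1r addNr (_ : addop _ _ = @op0 T) //.
  by apply/funext => a; apply/funext => b; rewrite /addop /scaleop mul1r mulN1r addNr.
have -> : hs (scaleop (-1) P) X = (-1)%:C%C * hs P X.
  rewrite /hs mulr_sumr; apply: eq_bigr => a _; rewrite mulr_sumr; apply: eq_bigr => b _.
  by rewrite /scaleop rmorphM rmorphN1 -mulrA rmorphN1.
by rewrite Re_scale mulN1r lerN2.
Qed.
End RealLinear.

(** * Operator arithmetic and Hermitian parts *)

Section OpArith.
Variable R : realType.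
Local Notation C := R[i].
Local Notation Re := complex.Re.
Local Notation Im := complex.Im.

Section OneSpace.
Variable T : finType.
Implicit Types A B : Op R T.

(** Positivity of the Hermitian part: [A] itself may be non-Hermitian, so that any operator is
    dominated by a multiple of the identity. *)
Definition rpsd A := forall v : T -> C, 0 <= Re (qform A v).

Lemma qformD A B v : qform (addop A B) v = qform A v + qform B v.
Proof.
rewrite /qform -big_split; apply: eq_bigr => a _; rewrite -big_split.
by apply: eq_bigr => b _; rewrite /addop mulrDr mulrDl.
Qed.

Lemma qformZ c A v : qform (scaleop c A) v = c * qform A v.
Proof.
rewrite /qform mulr_sumr; apply: eq_bigr => a _; rewrite mulr_sumr.
by apply: eq_bigr => b _; rewrite /scaleop; ring.
Qed.

Lemma subopE A B : subop A B = addop A (scaleop (-1) B).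
Proof. by apply/funext => a; apply/funext => b;
  rewrite /subop /addop /scaleop mulN1r. Qed.

Lemma qformB A B v : qform (subop A B) v = qform A v - qform B v.
Proof. by rewrite subopE qformD qformZ mulN1r. Qed.

Lemma qform_adj A v : qform (adjop A) v = (qform A v)^*.
Proof.
rewrite /qform exchange_big rmorph_sum; apply: eq_bigr => a _.
rewrite rmorph_sum; apply: eq_bigr => b _; rewrite /adjop !rmorphM /= conjCK.
by ring.
Qed.

Lemma qform1 v : qform (@op1 R T) v = \sum_a `|v a| ^+ 2.
Proof.
apply: eq_bigr => a _; rewrite (bigD1 a) //= /op1 eqxx mulr1 big1 ?addr0.
  by rewrite normCK mulrC.
by move=> b; rewrite eq_sym => /negbTE ->; rewrite mulr0 mul0r.
Qed.

Lemma qform0 v : qform (@op0 R T) v = 0.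
Proof. by apply: big1 => a _; apply: big1 => b _; rewrite mulr0 mul0r. Qed.

Lemma psd_add A B : psd A -> psd B -> psd (addop A B).
Proof. by move=> pA pB v; rewrite -/(qform _ _) qformD addr_ge0 // ?pA ?pB. Qed.

Lemma psd_scale c A : 0 <= c -> psd A -> psd (scaleop c A).
Proof. by move=> c0 pA v; rewrite -/(qform _ _) qformZ mulr_ge0 // pA. Qed.

Lemma psd0 : psd (@op0 R T).
Proof. by move=> v; rewrite -/(qform _ _) qform0. Qed.

Lemma hsDl A B X : hs (addop A B) X = hs A X + hs B X.
Proof.
rewrite /hs -big_split; apply: eq_bigr => a _; rewrite -big_split.
by apply: eq_bigr => b _; rewrite /addop rmorphD mulrDl.
Qed.

Lemma hsZl c A X : hs (scaleop c A) X = c^* * hs A X.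
Proof.
rewrite /hs mulr_sumr; apply: eq_bigr => a _; rewrite mulr_sumr.
by apply: eq_bigr => b _; rewrite /scaleop rmorphM mulrA.
Qed.

Lemma hsBl A B X : hs (subop A B) X = hs A X - hs B X.
Proof. by rewrite subopE hsDl hsZl rmorphN1 mulN1r. Qed.

Lemma hsBr X A B : hs X (subop A B) = hs X A - hs X B.
Proof. by rewrite hs_conj hsBl rmorphB [hs X A]hs_conj [hs X B]hs_conj. Qed.

Lemma Re_hsC A B : Re (hs A B) = Re (hs B A).
Proof. by rewrite hs_conj Re_conjE. Qed.

Lemma hs1 A : hs A (@op1 R T) = (trace A)^*.
Proof.
rewrite /hs rmorph_sum; apply: eq_bigr => a _.
rewrite (bigD1 a) //= /op1 eqxx mulr1 big1 ?addr0 //.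
by move=> b; rewrite eq_sym => /negbTE ->; rewrite mulr0.
Qed.

Lemma hs_eq0 A : Re (hs A A) = 0 -> forall a b, A a b = 0.
Proof.
move=> AA a b.
have hAA : hs A A = \sum_a \sum_b `|A a b| ^+ 2.
  by apply: eq_bigr => x _; apply: eq_bigr => y _; rewrite normCK mulrC.
have h0 : 0 <= hs A A.
  by rewrite hAA; apply: sumr_ge0 => x _; apply: sumr_ge0 => y _; rewrite exprn_ge0.
have := ge0_RRe h0; rewrite AA => /eqP; rewrite hAA psumr_eq0; last first.
  by move=> x _; apply: sumr_ge0 => y _; rewrite exprn_ge0.
move=> /allP /(_ a (mem_index_enum _)) /=; rewrite psumr_eq0; last first.
  by move=> y _; rewrite exprn_ge0.
move=> /allP /(_ b (mem_index_enum _)) /=.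
by rewrite sqrf_eq0 normr_eq0 => /eqP.
Qed.

Definition herm A : Op R T := scaleop 2^-1 (addop A (adjop A)).

Lemma psd_hermE A : psd A -> herm A = A.
Proof.
move=> pA; apply/funext => a; apply/funext => b; rewrite /herm /scaleop /addop /adjop.
by rewrite (psd_herm a b pA) conjCK; field.
Qed.

Lemma rpsd_herm A : rpsd A -> psd (herm A).
Proof.
move=> pA v; rewrite -/(qform _ _) /herm qformZ qformD qform_adj.
have -> : qform A v + (qform A v)^* = 2 * (Re (qform A v))%:C%C by rewrite -addcJ.
by rewrite mulKf ?pnatr_eq0 // ler0c pA.
Qed.

Lemma psd_rpsd A : psd A -> rpsd A.
Proof. by move=> pA v; apply: Re_ge0; exact: pA. Qed.

Lemma rpsd_add A B : rpsd A -> rpsd B -> rpsd (addop A B).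
Proof. by move=> pA pB v; rewrite qformD ReD addr_ge0 // ?pA ?pB. Qed.

Lemma rpsd_scale (c : R) A : 0 <= c -> rpsd A -> rpsd (scaleop c%:C%C A).
Proof. by move=> c0 pA v; rewrite qformZ Re_scale mulr_ge0 // pA. Qed.

Lemma trace_herm A : trace (herm A) = (Re (trace A))%:C%C.
Proof.
have -> : trace (herm A) = 2^-1 * (trace A + (trace A)^*).
  by rewrite /trace rmorph_sum -big_split mulr_sumr.
by rewrite -[_^*]/(_^*)%C addcJ mulKf ?pnatr_eq0.
Qed.

(** The constant is the sum of the moduli of all entries. *)
Lemma bounded_op A : exists c : R, rpsd (subop (scaleop c%:C%C (@op1 R T)) A).
Proof.
pose K : C := \sum_a \sum_b `|A a b|.
have K0 : 0 <= K by apply: sumr_ge0 => a _; apply: sumr_ge0 => b _.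
exists (Re K) => v; rewrite qformB qformZ qform1 -(ge0_RRe K0).
set N := \sum_a _; set q := qform A v.
have vN a : `|v a| ^+ 2 <= N.
  by rewrite /N (bigD1 a) //= lerDl; apply: sumr_ge0 => b _; rewrite exprn_ge0.
have qK : `|q| <= K * N.
  rewrite mulr_suml; apply: (le_trans (ler_norm_sum _ _ _)); apply: ler_sum => a _.
  rewrite mulr_suml; apply: (le_trans (ler_norm_sum _ _ _)); apply: ler_sum => b _.
  rewrite !normrM norm_conjC [_ * `|A a b|]mulrC -mulrA ler_wpM2l //.
  (* A product of two moduli is at most the larger square, hence at most [N]. *)
  have [va|va] := real_leP (normr_real (v a)) (normr_real (v b)).
    apply: le_trans (vN b); rewrite expr2 ler_wpM2r //.
  by apply: le_trans (vN a); rewrite expr2 ler_wpM2l // ltW.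
rewrite ReD; have := Re_le qK; have := Re_le (normc_ge_Re q); rewrite /=.
have -> : Re (- q) = - Re q by case: (q).
by move=> h1 h2; rewrite subr_ge0; apply: le_trans h2; apply: le_trans h1;
  exact: ler_norm.
Qed.

End OneSpace.

Section Bip.
Variables (S T Z : finType) (sp : bipartition S T Z).

Lemma ptrD A B : ptr sp (addop A B) = addop (ptr sp A) (ptr sp B) :> Op R T.
Proof. by apply/funext => a; apply/funext => b; rewrite /ptr /addop big_split. Qed.
Lemma ptrZ c A : ptr sp (scaleop c A) = scaleop c (ptr sp A) :> Op R T.
Proof. by apply/funext => a; apply/funext => b; rewrite /ptr /scaleop mulr_sumr. Qed.
Lemma ptr_adj A : ptr sp (adjop A) = adjop (ptr sp A) :> Op R T.
Proof. by apply/funext => a; apply/funext => b; rewrite /ptr /adjop rmorph_sum. Qed.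
Lemma ptr_herm A : ptr sp (herm A) = herm (ptr sp A) :> Op R T.
Proof. by rewrite /herm ptrZ ptrD ptr_adj. Qed.
Lemma ptr0 : ptr sp (@op0 R S) = @op0 R T.
Proof. by apply/funext => a; apply/funext => b; apply: big1. Qed.

Lemma tensID A B : tensI sp (addop A B) = addop (tensI sp A) (tensI sp B) :> Op R S.
Proof. by apply/funext => a; apply/funext => b; rewrite /tensI /addop mulrDr. Qed.
Lemma tensIZ c A : tensI sp (scaleop c A) = scaleop c (tensI sp A) :> Op R S.
Proof. by apply/funext => a; apply/funext => b; rewrite /tensI /scaleop mulrCA. Qed.
Lemma tensI_adj A : tensI sp (adjop A) = adjop (tensI sp A) :> Op R S.
Proof.
apply/funext => a; apply/funext => b; rewrite /tensI /adjop rmorphM rmorph_nat.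
by rewrite eq_sym.
Qed.
Lemma tensI_herm A : tensI sp (herm A) = herm (tensI sp A) :> Op R S.
Proof. by rewrite /herm tensIZ tensID tensI_adj. Qed.
Lemma tensI0 : tensI sp (@op0 R T) = @op0 R S.
Proof. by apply/funext => a; apply/funext => b; rewrite /tensI mulr0. Qed.

Lemma trace_ptr (A : Op R S) : trace (ptr sp A) = trace A.
Proof. by rewrite /trace (big_split_join sp). Qed.

Lemma rpsd_ptr (A : Op R S) : rpsd A -> rpsd (ptr sp A).
Proof.
move=> pA v; rewrite qform_ptr Re_sum; apply: sumr_ge0 => z _; exact: pA.
Qed.

(** The basis vector [z] matters: over an empty register [tensI] lives on the zero space and carries
    no information on [Q]. *)
Lemma rpsd_tensI (z : Z) (Q : Op R T) : rpsd (tensI sp Q) -> rpsd Q.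
Proof. by move=> pQ v; rewrite -(qform_tensI sp Q z). Qed.

End Bip.
End OpArith.

(** * Strategies and semidefinite duality *)

Section Chains.
Variables (R : realType) (BY BX : nat -> finType).
Local Notation C := R[i].
Local Notation Re := complex.Re.
Local Notation Im := complex.Im.
Local Notation L j := (tup BY j.+1 * tup BX j.+1)%type.
Local Notation spY j := (splitY BY BX j j.+1).
Local Notation spX j := (splitX BY BX j j).

(** Recursive form of [strategy], for inductions that peel off the last round. *)
Fixpoint is_strategy j : Op R (L j) -> Prop :=
  match j return Op R (L j) -> Prop with
  | 0 => fun X => psd X /\ ptr (spY 0) X = @op1 R _
  | j'.+1 => fun X => psd X /\
      exists2 X', is_strategy X' & ptr (spY j'.+1) X = tensI (spX j'.+1) X'
  end.

Lemma is_strategy_psd j X : @is_strategy j X -> psd X.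
Proof. by case: j X => [|j] X []. Qed.

Lemma strategyP j (X : Op R (L j)) : strategy X <-> is_strategy X.
Proof.
split=> [[Xs [Xpsd X0 XS <-]]|].
  have H k : (k <= j)%N -> is_strategy (Xs k).
    elim: k => [_|k IHk kj] /=; first by split; [exact: Xpsd | rewrite -ptrYE X0].
    split; first exact: Xpsd.
    by exists (Xs k); [exact/IHk/ltnW | rewrite -ptrYE XS].
  exact: H.
elim: j X => [|j IHj] X /= [psdX].
  (* Beyond the last round the family is arbitrary; [op0] fills it. *)
  move=> X0; exists (dfwith (fun k => @op0 R (L k)) X); split.
  - by move=> k; rewrite leqn0 => /eqP ->; rewrite dfwith_in.
  - by rewrite dfwith_in ptrYE.
  - by [].
  - by rewrite dfwith_in.
move=> [X' /IHj[Xs [Xpsd X0 XS XsE]] XE].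
have out k : (k <= j)%N -> dfwith Xs X k = Xs k.
  by move=> kj; rewrite dfwith_out // gtn_eqF.
exists (dfwith Xs X); split.
- move=> k; rewrite leq_eqVlt => /predU1P[->|kj]; first by rewrite dfwith_in.
  by rewrite out //; exact: Xpsd.
- by rewrite out.
- move=> k; rewrite ltnS leq_eqVlt => /predU1P[->|kj].
    by rewrite dfwith_in out // ptrYE XE XsE.
  by rewrite !out ?XS // ltnW.
- by rewrite dfwith_in.
Qed.

(* [rdual Z t]: the dual semidefinite programme for the objective [Z] has a
   feasible point of value [t]; only real parts are constrained, so that it is
   feasible for every (not necessarily Hermitian) [Z]. *)
Fixpoint rdual j : Op R (L j) -> R -> Prop :=
  match j return Op R (L j) -> R -> Prop with
  | 0 => fun Z t => exists2 Q, rpsd (subop (tensI (spY 0) Q) Z) & t = Re (trace Q)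
  | j'.+1 => fun Z t => exists2 Q, rpsd (subop (tensI (spY j'.+1) Q) Z) &
                          rdual (ptr (spX j'.+1) Q) t
  end.

(** The same programme with genuinely positive semidefinite [Q] and slacks, the form that survives
    tensor products. *)
Fixpoint dual_cert j : Op R (L j) -> R -> Prop :=
  match j return Op R (L j) -> R -> Prop with
  | 0 => fun Z t => exists Q,
      [/\ psd Q, psd (subop (tensI (spY 0) Q) Z) & trace Q = t%:C%C]
  | j'.+1 => fun Z t => exists Q,
      [/\ psd Q, psd (subop (tensI (spY j'.+1) Q) Z) & dual_cert (ptr (spX j'.+1) Q) t]
  end.

Lemma subopD (T : finType) (A A' B B' : Op R T) :
  subop (addop A A') (addop B B') = addop (subop A B) (subop A' B').
Proof. by apply/funext => a; apply/funext => b; rewrite /subop /addop opprD addrACA. Qed.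

Lemma subopZ (T : finType) c (A B : Op R T) :
  subop (scaleop c A) (scaleop c B) = scaleop c (subop A B).
Proof. by apply/funext => a; apply/funext => b; rewrite /subop /scaleop mulrBr. Qed.

Lemma traceD (T : finType) (A B : Op R T) : trace (addop A B) = trace A + trace B.
Proof. by rewrite /trace -big_split. Qed.

Lemma traceZ (T : finType) c (A : Op R T) : trace (scaleop c A) = c * trace A.
Proof. by rewrite /trace mulr_sumr. Qed.

Lemma rdualD j (A B : Op R (L j)) t u :
  rdual A t -> rdual B u -> rdual (addop A B) (t + u).
Proof.
elim: j A B => [|j IHj] A B /= [Q AQ tQ] [Q' BQ' uQ']; exists (addop Q Q').
- by rewrite tensID subopD; exact: rpsd_add.
- by rewrite traceD ReD tQ uQ'.
- by rewrite tensID subopD; exact: rpsd_add.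
- by rewrite ptrD; exact: IHj.
Qed.

Lemma rdualZ j (A : Op R (L j)) (c t : R) :
  0 <= c -> rdual A t -> rdual (scaleop c%:C%C A) (c * t).
Proof.
move=> c0; elim: j A => [|j IHj] A /= [Q AQ tQ]; exists (scaleop c%:C%C Q).
- by rewrite tensIZ subopZ; exact: rpsd_scale.
- by rewrite traceZ Re_scale tQ.
- by rewrite tensIZ subopZ; exact: rpsd_scale.
- by rewrite ptrZ; exact: IHj.
Qed.

(** At each round a large multiple of the identity is feasible. *)
Lemma rdual_total j (A : Op R (L j)) : exists t, rdual A t.
Proof.
have bnd i (Z : Op R (L i)) : exists Q, rpsd (subop (tensI (spY i) Q) Z).
  have [c cP] := bounded_op Z; exists (scaleop c%:C%C (@op1 R _)).
  by rewrite tensIZ tensI1.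
elim: j A => [|j IHj] A; have [Q QP] := bnd _ A.
  by exists (Re (trace Q)), Q.
by have [t tP] := IHj (ptr (spX j.+1) Q); exists t, Q.
Qed.

Lemma rdual0 j (A : Op R (L j)) : rpsd (scaleop (-1) A) -> rdual A 0.
Proof.
have sub0 (T : finType) (B : Op R T) : subop (@op0 R T) B = scaleop (-1) B.
  by apply/funext => a; apply/funext => b; rewrite /subop /scaleop add0r mulN1r.
elim: j A => [|j IHj] A An; exists (@op0 R _).
- by rewrite tensI0 sub0.
- by rewrite /trace big1.
- by rewrite tensI0 sub0.
- by rewrite ptr0; apply: IHj => v; rewrite qformZ qform0 mulr0.
Qed.

Lemma rpsd_tr (T : finType) (A : Op R T) : rpsd A -> 0 <= Re (trace A).
Proof.
move=> rA; rewrite /trace Re_sum; apply: sumr_ge0 => a _.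
have := rA (fun x => (x == a)%:R * 1 + (x == a)%:R * 0).
by rewrite qform_delta2 conjC0 conjC1 !(mulr0, mul0r, mul1r, mulr1, addr0).
Qed.

Lemma rpsd_sub (T : finType) (A B : Op R T) : rpsd (subop A B) -> rpsd B -> rpsd A.
Proof.
move=> AB pB; rewrite (_ : A = addop (subop A B) B); first exact: rpsd_add.
by apply/funext => a; apply/funext => b; rewrite /addop /subop subrK.
Qed.

(** Positivity descends the chain: I (x) Q dominates a positive operator, so Q is positive, and so
    is its partial trace. *)
Lemma rdual_ge0 j (A : Op R (L j)) t : (forall k, (k <= j)%N -> inhabited (BY k)) ->
  rpsd A -> rdual A t -> 0 <= t.
Proof.
elim: j A => [|j IHj] A inh pA /= [Q AQ tQ]; have [z] := inh _ (leqnn _).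
  by rewrite tQ; apply/rpsd_tr/(rpsd_tensI z)/(rpsd_sub AQ).
apply: IHj tQ => [k kj|]; first by apply: inh; exact: leqW.
exact/rpsd_ptr/(rpsd_tensI z)/(rpsd_sub AQ).
Qed.

(** Taking Hermitian parts commutes with [ptr] and [tensI], so it turns a chain for [rdual] into a
    certificate of the same value. *)
Lemma rdual_cert j (A : Op R (L j)) t : (forall k, (k <= j)%N -> inhabited (BY k)) ->
  rpsd A -> rdual A t -> dual_cert (herm A) t.
Proof.
have subh (T : finType) (B D : Op R T) : subop (herm B) (herm D) = herm (subop B D).
  by apply/funext => a; apply/funext => b;
     rewrite /subop /herm /scaleop /addop /adjop rmorphB; ring.
elim: j A => [|j IHj] A inh pA /= [Q AQ tQ]; have [z] := inh _ (leqnn _);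
  have pQ := rpsd_tensI z (rpsd_sub AQ pA); exists (herm Q).
  split; [exact: rpsd_herm | |by rewrite trace_herm tQ].
  by rewrite tensI_herm subh; exact: rpsd_herm.
split; [exact: rpsd_herm | |].
  by rewrite tensI_herm subh; exact: rpsd_herm.
rewrite ptr_herm; apply: IHj tQ => [k kj|]; first by apply: inh; exact: leqW.
exact: rpsd_ptr.
Qed.

(** For Re c <= 0 the operator c v v^* has dual value 0, which bounds the real part of conj(c) times
    the quadratic form. The choices -1, i and -i make that form nonnegative and real. *)
Lemma dominated_psd j (X : Op R (L j)) :
  (forall Z t, rdual Z t -> Re (hs Z X) <= t) -> psd X.
Proof.
move=> dom v; rewrite -/(qform _ _).
have H (c : C) : 0 <= Re (- c) -> Re (c^* * qform X v) <= 0.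
  move=> c0; pose Z : Op R (L j) := fun a b => c * (v a * (v b)^*).
  have -> : c^* * qform X v = hs Z X.
    rewrite /qform /hs mulr_sumr; apply: eq_bigr => a _; rewrite mulr_sumr.
    by apply: eq_bigr => b _; rewrite /Z !rmorphM /= conjCK; ring.
  apply/dom/rdual0 => w; rewrite qformZ.
  have -> : qform Z w = c * `|\sum_a (w a)^* * v a| ^+ 2.
    rewrite normCK rmorph_sum mulr_suml mulr_sumr; apply: eq_bigr => a _.
    rewrite mulr_sumr mulr_sumr; apply: eq_bigr => b _.
    by rewrite /Z rmorphM /= conjCK; ring.
  have n0 : 0 <= `|\sum_a (w a)^* * v a| ^+ 2 by rewrite exprn_ge0.
  by rewrite mulrA mulN1r (ge0_RRe n0) mulrC Re_scale mulr_ge0 // Re_ge0.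
have h1 := H (-1); have h2 := H ('i)%C; have h3 := H (- 'i)%C.
move: h1 h2 h3; case: (qform X v) => x y /=.
rewrite lecE /= !(mul0r, mulN1r, mul1r, oppr0, opprK, sub0r, mulr0, subr0, addr0, add0r).
move=> h1 h2 h3; have {}h1 := h1 ler01; have {}h2 := h2 (lexx _);
  have {}h3 := h3 (lexx _).
by apply/andP; split; [apply/eqP|]; lra.
Qed.

(** Chains with zero slack test the linear constraints. A constraint tested on an operator and on
    its negative becomes an equality, and each defect [D] turns out orthogonal to itself. *)
Lemma dominated_strategy j (X : Op R (L j)) :
  (forall k, (k <= j)%N -> inhabited (BX k)) ->
  (forall Z t, rdual Z t -> Re (hs Z X) <= t) -> is_strategy X.
Proof.
elim: j X => [|j IHj] X inh dom; (split; first exact: dominated_psd).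
  have rel Q : Re (hs Q (ptr (spY 0) X)) <= Re (trace Q).
    rewrite -hs_tensIl; apply: dom; exists Q => // v.
    by rewrite qformB subrr.
  set D := subop (ptr (spY 0) X) (@op1 R _).
  have D0 Q : Re (hs Q D) = 0.
    have -> : hs Q D = hs Q (ptr (spY 0) X) - (trace Q)^*.
      by rewrite hsBr hs1.
    rewrite ReD; have := rel Q; have := rel (scaleop (-1)%:C%C Q).
    have e1 : Re (- (trace Q)^*) = - Re (trace Q) by case: (trace Q).
    have e2 : ((-1)%:C%C : C)^* = (-1)%:C%C by exact: conjc_real.
    by rewrite traceZ hsZl e2 !Re_scale e1; lra.
  apply/funext => a; apply/funext => b; apply/eqP; rewrite -subr_eq0; apply/eqP.
  exact: (hs_eq0 (D0 D) a b).
have [x0] := inh j.+1 (leqnn _).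
have d0 : (#|BX j.+1|%:R : C) != 0 by rewrite pnatr_eq0 -lt0n; apply/card_gt0P; exists x0.
set G := ptr (spY j.+1) X.
have rel Q t : rdual (ptr (spX j.+1) Q) t -> Re (hs Q G) <= t.
  move=> Qt; rewrite /G -hs_tensIl; apply: dom; exists Q => // v.
  by rewrite qformB subrr.
pose d : R := #|BX j.+1|%:R^-1.
have dE : d%:C%C = (#|BX j.+1|%:R)^-1 :> C
  by rewrite /d rmorphV ?rmorph_nat // unitfE pnatr_eq0 -(@pnatr_eq0 C).
have dK (T : finType) (A : Op R T) :
    scaleop d%:C%C (fun a b => #|BX j.+1|%:R * A a b) = A.
  by apply/funext => a; apply/funext => b; rewrite /scaleop dE mulKf.
(* If G = I (x) X', then tracing out the last register multiplies X' by its dimension; hence the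
   factor [d]. *)
pose X' := scaleop d%:C%C (ptr (spX j.+1) G).
have conjd : ((d%:C)%C : C)^* = d%:C%C by exact: conjc_real.
exists X'.
  apply: IHj => [k kj|Z t Zt]; first by apply: inh; exact: leqW.
  (* Domination is inherited by [X'], because the partial trace of d (I (x) Z) is Z. *)
  have -> : Re (hs Z X') = Re (hs (scaleop d%:C%C (tensI (spX j.+1) Z)) G).
    rewrite Re_hsC /X' !hsZl conjd !Re_scale; congr (_ * _).
    by rewrite Re_hsC hs_tensIl.
  by apply: rel; rewrite ptrZ ptr_tensI dK.
set D := subop G (tensI (spX j.+1) X').
suff D0 : Re (hs D D) = 0.
  apply/funext => a; apply/funext => b; apply/eqP; rewrite -subr_eq0; apply/eqP.
  exact: (hs_eq0 D0 a b).
have pD : ptr (spX j.+1) D = @op0 R _.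
  rewrite /D subopE ptrD ptrZ ptr_tensI -subopE.
  have -> : (fun a b => #|BX j.+1|%:R * X' a b) = ptr (spX j.+1) G.
    by apply/funext => a; apply/funext => b; rewrite /X' /scaleop dE mulVKf.
  by apply/funext => a; apply/funext => b; rewrite /subop subrr.
(* Both [D] and [- D] are dual feasible with value 0, hence orthogonal to [G]. *)
have r0 : rdual (@op0 R (L j)) 0 by apply: rdual0 => v; rewrite qformZ qform0 mulr0.
have h1 : Re (hs D G) <= 0 by apply: rel; rewrite pD.
have h2 : Re (hs (scaleop (-1)%:C%C D) G) <= 0.
  apply: rel; rewrite ptrZ pD (_ : scaleop _ _ = @op0 R _) //.
  by apply/funext => a; apply/funext => b; rewrite /scaleop mulr0.
have e2 : ((-1)%:C%C : C)^* = (-1)%:C%C by exact: conjc_real.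
rewrite hsZl e2 Re_scale in h2.
have -> : hs D D = hs D G - hs D (tensI (spX j.+1) X').
  by rewrite {2}/D hsBr.
rewrite hs_tensIr pD (_ : hs (@op0 R _) X' = 0) ?subr0; first by lra.
by apply: big1 => a _; apply: big1 => b _; rewrite conjC0 mul0r.
Qed.

(** Nonempty [BY] registers keep the dual value at 0 nonnegative; nonempty [BX] registers allow
    division by dimensions when earlier rounds are recovered. *)
Lemma strong_duality j (P : Op R (L j)) (m : R) :
  (forall k, (k <= j)%N -> inhabited (BY k)) ->
  (forall k, (k <= j)%N -> inhabited (BX k)) ->
  (forall t, rdual P t -> m <= t) ->
  exists2 X, is_strategy X & m <= Re (hs P X).
Proof.
move=> inhY inhX Pm.
have [||||| X dom mX] := @separating_op R _ (@rdual j) P m.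
- exact: rdualD.
- by move=> c A t; exact: rdualZ.
- exact: rdual_total.
- by move=> t; apply: rdual_ge0 => // v; rewrite qform0.
- exact: Pm.
by exists X => //; exact: dominated_strategy.
Qed.

End Chains.

(** * Chernoff rates *)

Section Rates.
Variable R : realType.
Implicit Types c l u : R.

(** For l > 0 the third hypothesis puts [u] strictly between 1 and c / l, on either side of 1, so
    both tails are covered. It says (u - 1) l < c (1 - 1/u), and ln(1 + x) <= x bounds both
    logarithms. *)
Lemma chernoff_rate_gt0 c l u : 0 < u -> 0 < 1 + (u - 1) * l ->
  (u - 1) * (l * u - c) < 0 -> 0 < c ->
  0 < c * ln u - ln (1 + (u - 1) * l).
Proof.
move=> u0 b0 h c0.
have h1 : ln (1 + (u - 1) * l) <= (u - 1) * l by apply: le_ln1Dx; lra.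
have h2 : - ln u <= u^-1 - 1.
  have V0 : 0 < u^-1 by rewrite invr_gt0.
  rewrite -lnV ?posrE // -[X in ln X](addrNK 1) addrC; apply: le_ln1Dx; lra.
have h3 : c * (1 - u^-1) <= c * ln u by rewrite ler_pM2l //; lra.
have h4 : (u - 1) * l < c * (1 - u^-1).
  rewrite -(ltr_pM2r u0) -subr_lt0.
  have -> : (u - 1) * l * u - c * (1 - u^-1) * u = (u - 1) * (l * u - c); last by [].
  by field; rewrite gt_eqF.
lra.
Qed.

Lemma expn_expR (x : R) n : 0 < x -> x ^+ n = expR (n%:R * ln x).
Proof. by move=> x0; rewrite expRM_natl lnK. Qed.

(** The extra factor [u] pays for rounding the threshold down by at most 1. *)
Lemma chernoff_upper c l u (n k : nat) :
  1 < u -> 0 <= l -> c * n%:R - 1 <= k%:R ->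
  (1 + (u - 1) * l) ^+ n <=
    u * expR (- (c * ln u - ln (1 + (u - 1) * l)) * n%:R) * u ^+ k.
Proof.
move=> u1 l0 kn; have u0 : 0 < u by lra.
have b0 : 0 < 1 + (u - 1) * l.
  by rewrite ltr_pwDl // mulr_ge0 // subr_ge0 ltW.
rewrite (expn_expR _ b0) (expn_expR _ u0) -{2}(lnK u0) -!expRD ler_expR.
set x := ln (1 + _); set y := ln u.
have y0 : 0 < y by rewrite ln_gt0.
have : 0 <= (k%:R - (c * n%:R - 1)) * y by rewrite mulr_ge0 ?subr_ge0 // ltW.
lra.
Qed.

(** Here u < 1, so rounding the threshold down only increases u^k. *)
Lemma chernoff_lower c l u (n k : nat) :
  0 < u < 1 -> l <= 1 -> k%:R <= c * n%:R ->
  (1 + (u - 1) * l) ^+ n <=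
    expR (- (c * ln u - ln (1 + (u - 1) * l)) * n%:R) * u ^+ k.
Proof.
move=> /andP[u0 u1] l1 kn.
have b0 : 0 < 1 + (u - 1) * l.
  have : 0 <= (1 - u) * (1 - l) by rewrite mulr_ge0 ?subr_ge0 // ltW.
  lra.
rewrite (expn_expR _ b0) (expn_expR _ u0) -!expRD ler_expR.
set x := ln (1 + _); set y := ln u.
have y0 : y < 0 by rewrite ln_lt0 // u0.
have : 0 <= (c * n%:R - k%:R) * - y by rewrite mulr_ge0 ?subr_ge0 ?oppr_ge0 // ltW.
lra.
Qed.

End Rates.

Section Words.
Variables (K : comPzRingType) (n : nat).

(** Generating function of the number of ones, by expanding the product over coordinates. *)
Lemma sum_words (w : K) (f : 'I_n -> bool -> K) :
  \sum_(s : {ffun 'I_n -> bool}) w ^+ #|[pred i | s i]| * \prod_i f i (s i) =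
  \prod_i (f i false + w * f i true).
Proof.
transitivity (\prod_(i < n) \sum_(o : bool) (if o then w else 1) * f i o).
  rewrite bigA_distr_bigA; apply: eq_bigr => s _; rewrite big_split /=; congr (_ * _).
  by rewrite -big_mkcond /= prodr_const.
by apply: eq_bigr => i _; rewrite big_bool mul1r addrC.
Qed.
End Words.

(** * Verifiers *)

Section Verifiers.
Variables (R : realType) (BY BX : nat -> finType).
Local Notation C := R[i].
Local Notation Re := complex.Re.
Local Notation L j := (tup BY j.+1 * tup BX j.+1)%type.
Local Notation spY j := (splitY BY BX j j.+1).
Local Notation spX j := (splitX BY BX j j).
Local Notation cert := (@dual_cert R BY BX).

Lemma trace_psd (T : finType) (A : Op R T) : psd A -> 0 <= trace A.
Proof.
move=> pA; apply: sumr_ge0 => a _.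
have := pA (fun x => (x == a)%:R * 1 + (x == a)%:R * 0); rewrite -/(qform _ _).
by rewrite qform_delta2 conjC0 conjC1 !(mulr0, mul0r, mul1r, mulr1, addr0).
Qed.

Lemma dual_certD j (A B : Op R (L j)) t u :
  cert A t -> cert B u -> cert (addop A B) (t + u).
Proof.
elim: j A B => [|j IHj] A B /= [Q [pQ AQ tQ]] [Q' [pQ' BQ' uQ']]; exists (addop Q Q').
  split; [exact: psd_add | by rewrite tensID subopD; exact: psd_add |].
  by rewrite traceD tQ uQ' -rmorphD.
split; [exact: psd_add | by rewrite tensID subopD; exact: psd_add |].
by rewrite ptrD; exact: IHj.
Qed.

Lemma dual_certZ j (A : Op R (L j)) (c t : R) :
  0 <= c -> cert A t -> cert (scaleop c%:C%C A) (c * t).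
Proof.
move=> c0; have c0' : 0 <= (c%:C%C : C) by rewrite ler0c.
elim: j A => [|j IHj] A /= [Q [pQ AQ tQ]]; exists (scaleop c%:C%C Q).
  split; [exact: psd_scale | by rewrite tensIZ subopZ; exact: psd_scale |].
  by rewrite traceZ tQ -rmorphM.
split; [exact: psd_scale | by rewrite tensIZ subopZ; exact: psd_scale |].
by rewrite ptrZ; exact: IHj.
Qed.

Lemma dual_cert_ge0 j (A : Op R (L j)) t : cert A t -> 0 <= t.
Proof.
elim: j A => [|j IHj] A /= [Q [pQ AQ tQ]]; last exact: IHj tQ.
by rewrite -ler0c -tQ trace_psd.
Qed.

Lemma dual_cert0 j : cert (@op0 R (L j)) 0.
Proof.
have sub0 (T : finType) : subop (@op0 R T) (@op0 R T) = @op0 R T.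
  by apply/funext => a; apply/funext => b; rewrite /subop subrr.
elim: j => [|j IHj]; exists (@op0 R _).
  by split; [exact: psd0 | rewrite tensI0 sub0; exact: psd0 | rewrite /trace big1].
by split; [exact: psd0 | rewrite tensI0 sub0; exact: psd0 | rewrite ptr0].
Qed.

Lemma dual_cert_empty j (A : Op R (L j)) : (L j -> False) -> cert A 0.
Proof.
move=> emp; rewrite (_ : A = @op0 R _); first exact: dual_cert0.
by apply/funext => a; have := emp a.
Qed.

Variables (r : nat) (P0 P1 : Op R (L r)).
Hypothesis ver : verifier P0 P1.

Lemma verifier_psd o : psd (Pof P0 P1 o).
Proof. by have [Rs [_ _ _ [p0 p1] _]] := ver; case: o. Qed.

(** The verifier's own operators [Rs] form the chain, with every inequality an equality. *)
Lemma verifier_cert : cert (addop P0 P1) 1.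
Proof.
have [Rs [[_ tR] Rpsd RS _ PE]] := ver.
rewrite (_ : addop P0 P1 = tensI (spY r) (Rs r)) //.
have subxx (T : finType) (A : Op R T) : psd (subop A A).
  by move=> v; rewrite -/(qform _ _) qformB subrr.
suff H j : (j <= r)%N -> cert (tensI (spY j) (Rs j)) 1 by exact: H.
elim: j => [|j IHj] jr; exists (Rs _).
  by split; [exact: Rpsd | exact: subxx | rewrite tR].
by split; [exact: Rpsd | exact: subxx | rewrite -ptrXE RS //; exact/IHj/ltnW].
Qed.

(** Constraints of verifier and strategy are applied alternately, round by round, until only the
    trace of the initial density operator remains. *)
Lemma verifier_total (X : Op R (L r)) : is_strategy X ->
  hs P0 X + hs P1 X = 1.
Proof.
have [Rs [[_ tR] Rpsd RS _ PE]] := ver.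
rewrite -hsDl (_ : addop P0 P1 = tensI (spY r) (Rs r)) //.
suff H j (Y : Op R (L j)) : (j <= r)%N -> is_strategy Y -> hs (tensI (spY j)
  (Rs j)) Y = 1.
  exact: H.
elim: j Y => [|j IHj] Y jr /= [_].
  by move=> YE; rewrite hs_tensIl YE hs1 tR conjC1.
move=> [Y' strY' YE]; rewrite hs_tensIl YE hs_tensIr -ptrXE RS //.
by apply: IHj => //; exact: ltnW.
Qed.

(** The trace of each [Rs j] is a product of dimensions of [BY] registers, hence nonzero, so the
    space it acts on has a basis vector. *)
Lemma verifier_inhX : (forall k, (k <= r)%N -> inhabited (BY k)) ->
  forall k, (k <= r)%N -> inhabited (BX k).
Proof.
move=> inh; have [Rs [[_ tR] Rpsd RS _ _]] := ver.
have tn0 j : (j <= r)%N -> trace (Rs j) != 0.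
  elim: j => [|j IHj] jr; first by rewrite tR oner_eq0.
  rewrite -(trace_ptr (splitX BY BX j.+1 j.+1)) -ptrXE RS // tensIYE -(trace_ptr (spY j)).
  rewrite ptr_tensI -/(scaleop _ _) traceZ mulf_neq0 ?IHj ?(ltnW jr) //.
  by rewrite pnatr_eq0 -lt0n; apply/card_gt0P; have [y] := inh j (ltnW jr); exists y.
move=> k kr; have := tn0 k kr; apply: contra_neqP => nX.
apply: big1 => -[a x] _; case: nX; constructor; exact: (lastt x).
Qed.

Lemma verifier_value_le1 (X : Op R (L r)) : is_strategy X ->
  0 <= Re (hs P1 X) <= 1 /\ hs P1 X = (Re (hs P1 X))%:C%C /\
  hs P0 X = (1 - Re (hs P1 X))%:C%C.
Proof.
move=> sX; have tot := verifier_total sX.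
have pX := is_strategy_psd sX.
have h0 := hs_psd_ge0 (verifier_psd false) pX.
have h1 := hs_psd_ge0 (verifier_psd true) pX.
have e1 := ge0_RRe h1; rewrite /= in h0 h1 e1.
have e0 : hs P0 X = (1 - Re (hs P1 X))%:C%C by rewrite rmorphB rmorph1 /= -e1 -tot addrK.
split; last by [].
move: h0; rewrite e0 ler0c subr_ge0 => ->; rewrite andbT; exact: Re_ge0.
Qed.

(** If no dual value were below [l], strong duality would give a strategy of value at least [l],
    above the supremum. *)
Lemma pval_cert l : pval P1 < l -> 0 <= l -> exists2 t, t <= l & cert P1 t.
Proof.
move=> pl l0.
have [inh|ninh] := pselect (forall k, (k <= r)%N -> inhabited (BY k)); last first.
  (* An empty [BY] register makes the whole space zero, and value 0 is certified there. *)
  exists 0 => //; apply: dual_cert_empty => -[y _]; apply: ninh => k kr.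
  constructor; exact: (y (Ordinal (kr : (k < r.+1)%N))).
have [t [tl dt]] : exists t, t < l /\ rdual P1 t.
  apply: contrapT => H.
  have [t dt|X sX lX] := strong_duality (P := P1) (m := l) inh (verifier_inhX inh).
    by rewrite leNgt; apply/negP => tl; apply: H; exists t.
  have : Re (hs P1 X) <= pval P1.
    apply: ub_le_sup; last by exists X => //; exact/strategyP.
    exists 1 => _ [Y /strategyP sY <-].
    by have [/andP[]] := verifier_value_le1 sY.
  by move=> h; have := lt_le_trans pl (le_trans lX h); rewrite ltxx.
exists t; first exact: ltW.
have pP : psd P1 := verifier_psd true.
by rewrite -(psd_hermE pP); apply: rdual_cert => //; exact: psd_rpsd.
Qed.

End Verifiers.

(** * Parallel repetition *)

Section Parallel.
Variables (R : realType) (BY BX : nat -> finType) (n : nat).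
Local Notation C := R[i].
Local Notation Re := complex.Re.
Local Notation L j := (tup BY j.+1 * tup BX j.+1)%type.
Local Notation Ln j := (tup (copies n BY) j.+1 * tup (copies n BX) j.+1)%type.
Local Notation spY j := (splitY BY BX j j.+1).
Local Notation spX j := (splitX BY BX j j).
Local Notation spYn j := (splitY (copies n BY) (copies n BX) j j.+1).
Local Notation spXn j := (splitX (copies n BY) (copies n BX) j j).
Local Notation ppair jy jx := (@proj_pair BY BX n jy jx).
Local Notation tensn A := (tens (@proj_pair BY BX n _ _) A).

Lemma proj_pair_joinY j i t z :
  ppair _ _ i (join (spYn j) t z) = join (spY j) (ppair _ _ i t) (z i).
Proof. by rewrite /proj_pair /= proj_copy_snoc. Qed.

Lemma proj_pair_joinX j i t z :
  ppair _ _ i (join (spXn j) t z) = join (spX j) (ppair _ _ i t) (z i).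
Proof. by rewrite /proj_pair /= proj_copy_snoc. Qed.

Lemma tens_ptrY j (A : 'I_n -> Op R (L j)) :
  ptr (spYn j) (tensn A) = tensn (fun i => ptr (spY j) (A i)).
Proof. by rewrite (tens_ptr (@proj_pair_joinY j)). Qed.

Lemma tens_ptrX j (A : 'I_n -> Op R (tup BY j * tup BX j.+1)%type) :
  ptr (spXn j) (tensn A) = tensn (fun i => ptr (spX j) (A i)).
Proof. by rewrite (tens_ptr (@proj_pair_joinX j)). Qed.

Lemma tens_tensIY j (A : 'I_n -> Op R (tup BY j * tup BX j.+1)%type) :
  tensI (spYn j) (tensn A) = tensn (fun i => tensI (spY j) (A i)).
Proof. by rewrite (tens_tensI (@proj_pair_joinY j)). Qed.

Lemma tens_tensIX j (A : 'I_n -> Op R (tup BY j * tup BX j)%type) :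
  tensI (spXn j) (tensn A) = tensn (fun i => tensI (spX j) (A i)).
Proof. by rewrite (tens_tensI (@proj_pair_joinX j)). Qed.

Lemma tens_op1 jy jx :
  tens (ppair jy jx) (fun=> @op1 R _) = @op1 R _.
Proof.
apply/funext => a; apply/funext => b; rewrite /tens /op1.
case: eqP => [->|ab]; first by rewrite big1 // => i _; rewrite eqxx.
have [i ni] : exists i, ppair jy jx i a != ppair jy jx i b.
  apply: contrapT => H; apply: ab.
  have e i : ppair jy jx i a = ppair jy jx i b.
    by apply/eqP/negPn/negP => ni; apply: H; exists i.
  case: a b e {H} => [a1 a2] [b1 b2] e; congr (_, _); apply/ffunP => k; apply/ffunP => i.
    by have [/ffunP /(_ k)] := e i; rewrite !ffunE.
  by have [_ /ffunP /(_ k)] := e i; rewrite !ffunE.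
by rewrite (bigD1 i) //= (negbTE ni) mul0r.
Qed.

Lemma is_strategy_tens j (X : Op R (L j)) : is_strategy X ->
  is_strategy (tensn (fun=> X) : Op R (Ln j)).
Proof.
elim: j X => [|j IHj] X /= [pX].
  move=> XE; split; first exact: psd_prod.
  by rewrite tens_ptrY XE tens_op1.
move=> [X' sX' XE]; split; first exact: psd_prod.
by exists (tensn (fun=> X')); [exact: IHj | rewrite tens_ptrY tens_tensIX XE].
Qed.

(** Expanding each B_i as A_i + (B_i - A_i) writes the tensor product of the B_i as a sum of
    positive terms, one of which is the product of the A_i. *)
Lemma hs_tens_le (I S T : finType) (p : I -> S -> T) (A B : I -> Op R T) (X : Op R S) :
  (forall i, psd (A i)) -> (forall i, psd (subop (B i) (A i))) -> psd X ->
  hs (tens p A) X <= hs (tens p B) X.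
Proof.
move=> pA pBA pX.
pose F (f : {ffun I -> bool}) : Op R S :=
  tens p (fun i => if f i then A i else subop (B i) (A i)).
have BE : tens p B = fun a b => \sum_f F f a b.
  apply/funext => a; apply/funext => b.
  transitivity (\prod_i \sum_(o : bool) (if o then A i else subop (B i) (A i)) (p i a)
    (p i b)).
    by apply: eq_bigr => i _; rewrite big_bool /= /subop addrC subrK.
  by rewrite bigA_distr_bigA.
have -> : hs (tens p B) X = \sum_f hs (F f) X.
  rewrite BE /hs.
  under eq_bigr => a _ do under eq_bigr => b _ do rewrite rmorph_sum mulr_suml.
  under eq_bigr => a _ do rewrite exchange_big.
  by rewrite exchange_big.
rewrite (bigD1 [ffun=> true]) //=.
have -> : F [ffun=> true] = tens p A.
  by apply/funext => a; apply/funext => b; apply: eq_bigr => i _; rewrite ffunE.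
rewrite lerDl; apply: sumr_ge0 => f _; apply: hs_psd_ge0 => //.
by apply: psd_prod => i; case: (f i).
Qed.

(** Only the dual chains factorise, so [X] may correlate the copies arbitrarily. Each round replaces
    Z_i by I (x) Q_i and moves the identities across the pairing onto the constraints of [X]. *)
Lemma weak_duality j (Z : 'I_n -> Op R (L j)) (t : 'I_n -> R) (X : Op R (Ln j)) :
  (forall i, psd (Z i)) -> (forall i, dual_cert (Z i) (t i)) -> is_strategy X ->
  hs (tensn Z) X <= (\prod_i t i)%:C%C.
Proof.
elim: j Z X => [|j IHj] Z X pZ cZ sX; have pX := is_strategy_psd sX.
  have /choice[Q QP] := cZ.
  have le1 : hs (tensn Z) X <= hs (tensn (fun i => tensI (spY 0) (Q i))) X.
    by apply: hs_tens_le => // i; have [] := QP i.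
  apply: le_trans le1 _.
  rewrite -tens_tensIY hs_tensIl; case: sX => _ ->.
  rewrite hs1 trace_tens rmorph_prod rmorph_prod.
  apply: ler_prod => i _ /=; have [_ _ tQ] := QP i.
  have /= -> : (trace (Q i))^* = (t i)%:C%C by rewrite tQ; exact: conjc_real.
  rewrite lexx andbT ler0c; exact: dual_cert_ge0 (cZ i).
have /choice[Q QP] := cZ.
have le1 : hs (tensn Z) X <= hs (tensn (fun i => tensI (spY j.+1) (Q i))) X.
  by apply: hs_tens_le => // i; have [] := QP i.
apply: le_trans le1 _.
case: sX => _ [X' sX' XE].
rewrite -tens_tensIY hs_tensIl XE hs_tensIr tens_ptrX; apply: IHj => // i.
  by apply: psd_ptr; have [] := QP i.
by have [] := QP i.
Qed.

(** The tensor power of P_0 + w P_1 is expanded over words, matrix entry by matrix entry. *)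
Lemma tens_mgf r (P0 P1 : Op R (L r)) (w : R) (X : Op R (Ln r)) :
  \sum_(s : {ffun 'I_n -> bool}) w ^+ #|[pred i | s i]| * Re (hs (tensP
    (Pof P0 P1) s) X) =
  Re (hs (tensn (fun=> addop P0 (scaleop w%:C%C P1))) X).
Proof.
rewrite /hs Re_sum.
under eq_bigr => s _ do rewrite Re_sum mulr_sumr.
rewrite exchange_big; apply: eq_bigr => a _; rewrite Re_sum /=.
under eq_bigr => s _ do rewrite Re_sum mulr_sumr.
rewrite exchange_big; apply: eq_bigr => b _ /=.
rewrite /tens /addop /scaleop /=.
rewrite -(sum_words (w%:C%C : C) (fun i o =>
  Pof P0 P1 o (ppair _ _ i a) (ppair _ _ i b))).
rewrite rmorph_sum mulr_suml Re_sum; apply: eq_bigr => s _.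
have -> : ((w%:C)%C ^+ #|[pred i | s i]| : C) = (w ^+ #|[pred i | s i]|)%:C%C
  by rewrite rmorphXn.
rewrite rmorphM /= -mulrA.
have -> : ((w ^+ #|[pred i | s i]|)%:C%C : C)^* = (w ^+ #|[pred i | s i]|)%:C%C
  by exact: conjc_real.
by rewrite Re_scale.
Qed.

Lemma parallel_mgf r (P0 P1 : Op R (L r)) (w t : R) (X : Op R (Ln r)) :
  verifier P0 P1 -> 0 <= w -> dual_cert (addop P0
    (scaleop w%:C%C P1)) t -> is_strategy X ->
  \sum_(s : {ffun 'I_n -> bool}) w ^+ #|[pred i | s i]| * Re (hs (tensP
    (Pof P0 P1) s) X) <=
  t ^+ n.
Proof.
move=> ver w0 ct sX; rewrite tens_mgf.
have -> : t ^+ n = Re (\prod_(i < n) t)%:C%C by rewrite prodr_const card_ord.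
apply: Re_le; apply: (weak_duality (t := fun=> t)) => // i.
apply: psd_add; first exact: (verifier_psd ver false).
by apply: psd_scale; [rewrite ler0c | exact: (verifier_psd ver true)].
Qed.

Lemma tensP_ge0 r (P0 P1 : Op R (L r)) s (X : Op R (Ln r)) :
  verifier P0 P1 -> psd X -> 0 <= Re (hs (tensP (Pof P0 P1) s) X).
Proof.
move=> ver pX; apply/Re_ge0/hs_psd_ge0 => //.
by apply: (psd_prod (A := fun i => Pof P0 P1 (s i)) (ppair _ _)) => i;
  exact: verifier_psd.
Qed.

(** The moment bound at w = 1, where P_0 + P_1 has a certificate of value 1. *)
Lemma parallel_value_le1 r (P0 P1 : Op R (L r)) (Q : pred {ffun 'I_n -> bool})
  (X : Op R (Ln r)) :
  verifier P0 P1 -> is_strategy X ->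
  \sum_(s | Q s) Re (hs (tensP (Pof P0 P1) s) X) <= 1.
Proof.
move=> ver sX; have pX := is_strategy_psd sX.
have c1 : dual_cert (addop P0 (scaleop 1%:C%C P1)) 1.
  rewrite (_ : scaleop _ P1 = P1); first exact: verifier_cert.
  by apply/funext => a; apply/funext => b; rewrite /scaleop mul1r.
have := parallel_mgf ver ler01 c1 sX; rewrite expr1n; apply: le_trans.
rewrite big_mkcond; apply: ler_sum => s _; rewrite expr1n mul1r.
by case: ifP => // _; exact: tensP_ge0.
Qed.

(** Markov's inequality: u^k is at most u^(number of ones) on the words counted, and the moment
    bound applies to (P_0 + P_1) + (u - 1) P_1. *)
Lemma soundness_bound r (P0 P1 : Op R (L r)) (u l : R) (k : nat) (X : Op R (Ln r)) :
  verifier P0 P1 -> is_strategy X -> 1 < u -> 0 <= l -> pval P1 < l ->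
  (\sum_(s : {ffun 'I_n -> bool} | (k <= #|[pred i | s i]|)%N)
    Re (hs (tensP (Pof P0 P1) s) X)) * u ^+ k <= (1 + (u - 1) * l) ^+ n.
Proof.
move=> ver sX u1 l0 pl; have pX := is_strategy_psd sX.
have [t tl ct] := pval_cert ver pl l0; have t0 := dual_cert_ge0 ct.
have u10 : 0 <= u - 1 by rewrite subr_ge0 ltW.
have u0 : 0 <= u by rewrite ltW // (lt_trans ltr01).
have c : dual_cert (addop P0 (scaleop u%:C%C P1)) (1 + (u - 1) * t).
  rewrite (_ : addop _ _ = addop (addop P0 P1) (scaleop (u - 1)%:C%C P1)).
    by apply: dual_certD; [exact: verifier_cert | exact: dual_certZ].
  apply/funext => a; apply/funext => b; rewrite /addop /scaleop rmorphB rmorph1; ring.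
apply: (@le_trans _ _ ((1 + (u - 1) * t) ^+ n)); last first.
  rewrite lerXn2r ?nnegrE ?addr_ge0 ?mulr_ge0 //.
  by rewrite lerD2l ler_wpM2l.
apply: le_trans (parallel_mgf ver u0 c sX).
rewrite mulr_suml big_mkcond; apply: ler_sum => s _.
have h0 := tensP_ge0 s ver pX.
case: ifP => ks; last by rewrite mulr_ge0 // exprn_ge0.
by rewrite mulrC ler_wpM2r // ler_weXn2l // ltW.
Qed.

(** Playing [X] on every copy makes the outcomes independent with success probability [q]. As u < 1,
    words with fewer than [k] ones satisfy u^k <= u^(number of ones), and the moments decrease in
    [q]. *)
Lemma completeness_bound r (P0 P1 : Op R (L r)) (u l : R) (k : nat) (X : Op R (L r)) :
  verifier P0 P1 -> is_strategy X -> 0 < u < 1 -> l <= Re (hs P1 X) ->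
  (1 - \sum_(s : {ffun 'I_n -> bool} | (k <= #|[pred i | s i]|)%N)
    Re (hs (tensP (Pof P0 P1) s) (tensn (fun=> X)))) * u ^+ k <= (1 + (u - 1) * l) ^+ n.
Proof.
move=> ver sX /andP[u0 u1] lq.
have [/andP[q0 q1] [e1 e0]] := verifier_value_le1 ver sX.
set q := Re (hs P1 X) in q0 q1 e1 e0 lq.
pose h (s : {ffun 'I_n -> bool}) : R := \prod_i (if s i then q else 1 - q).
have hE (s : {ffun 'I_n -> bool}) : Re (hs (tensP (Pof P0 P1) s) (tensn (fun=> X))) = h s.
  have -> : hs (tensP (Pof P0 P1) s) (tensn (fun=> X)) = (h s)%:C%C.
    rewrite -[LHS]/(hs (tensn (fun i => Pof P0 P1 (s i))) _) hs_tens rmorph_prod.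
    by apply: eq_bigr => i _; case: (s i).
  by [].
have h0 s : 0 <= h s by apply: prodr_ge0 => i _; case: ifP; rewrite ?subr_ge0.
have mgf w : \sum_(s : {ffun 'I_n -> bool}) w ^+ #|[pred i | s i]| * h s =
  (1 + (w - 1) * q) ^+ n.
  rewrite (sum_words w (fun i (o : bool) => if o then q else 1 - q)) prodr_const card_ord.
  by congr (_ ^+ _); ring.
under eq_bigr => s _ do rewrite hE.
have -> : 1 - \sum_(s : {ffun 'I_n -> bool} | (k <= #|[pred i | s i]|)%N) h s =
    \sum_(s : {ffun 'I_n -> bool} | ~~ (k <= #|[pred i | s i]|)%N) h s.
  have <- : \sum_s h s = 1.
    have := mgf 1; rewrite subrr mul0r addr0 expr1n => <-.
    by apply: eq_bigr => s _; rewrite expr1n mul1r.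
  rewrite [X in X - _](bigID (fun s : {ffun 'I_n -> bool} =>
    (k <= #|[pred i | s i]|)%N)) /=.
  by rewrite addrAC subrr add0r.
apply: (@le_trans _ _ ((1 + (u - 1) * q) ^+ n)); last first.
  have b0 : 0 <= 1 + (u - 1) * q.
    have : 0 <= (1 - u) * (1 - q) by rewrite mulr_ge0 ?subr_ge0 // ltW.
    lra.
  have bl : 1 + (u - 1) * q <= 1 + (u - 1) * l
    by rewrite lerD2l ler_wnM2l // subr_le0 ltW.
  by rewrite lerXn2r ?nnegrE // (le_trans b0).
rewrite -mgf mulr_suml big_mkcond; apply: ler_sum => s _.
case: ifP => ks; last by rewrite mulr_ge0 // exprn_ge0 // ltW.
by rewrite mulrC ler_wpM2r // ler_wiXn2l ?(ltW u0) ?(ltW u1) // ltnW // ltnNge.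
Qed.

End Parallel.

(** * Threshold values and the choice of constants *)

Lemma pval_nE (R : realType) (BY BX : nat -> finType) (r : nat)
    (P0 P1 : Op R (tup BY r.+1 * tup BX r.+1)%type) (n k : nat) :
  pval_n P0 P1 n k%:Z =
  sup [set \sum_(s : {ffun 'I_n -> bool} | (k <= #|[pred i | s i]|)%N)
             complex.Re (hs (tensP (Pof P0 P1) s) X)
      | X in [set X | @is_strategy R (copies n BY) (copies n BX) r X]]%classic.
Proof.
rewrite /pval_n; congr sup; apply/seteqP; split=> _ [X /strategyP sX <-]; exists X => //=;
  by rewrite Re_sum.
Qed.

Theorem theorem7p1 (R : realType) (alpha beta : R) :
  0 <= beta ->
  beta < powR 2 (- binH alpha / alpha) ->
  powR 2 (- binH alpha / alpha) < alpha ->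
  alpha <= 1 ->
  exists c : rat, [/\ 0 < c, ratr c < alpha &
  exists C : R, 0 < C /\
    forall (eps : R), 0 < eps -> eps <= 2^-1 ->
    forall n : nat, C * ln (eps^-1) <= n%:R ->
    forall (r' : nat) (BY BX : nat -> finType)
           (P0 P1 : Op R (tup BY r'.+1 * tup BX r'.+1)%type),
      verifier P0 P1 ->
      (alpha <= pval P1 ->
         1 - eps <= pval_n P0 P1 n (Num.floor (c * n%:R))) /\
      (pval P1 <= beta ->
         pval_n P0 P1 n (Num.floor (c * n%:R)) <= eps)].
Proof.
move=> beta0 beta_lt lt_alpha alpha1.
have [q] := rat_in_itvoo (lt_trans beta_lt lt_alpha).
rewrite in_itv /= => /andP[]; set c : R := ratr q => bc ca.
have c0 : 0 < c by exact: le_lt_trans beta0 bc.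
(* [l] lies strictly above [beta], leaving room for a dual certificate of value at most [l]; [u] is
   the midpoint of 1 and c / l, as the rate lemma requires. *)
pose l := (beta + c) / 2; pose u := (1 + c / l) / 2.
have l0 : 0 < l by rewrite /l; lra.
have bl : beta < l by rewrite /l; lra.
have cl1 : 1 < c / l by rewrite ltr_pdivlMr // mul1r /l; lra.
have lu : l * u < c.
  rewrite /u mulrA mulrDr mulr1 mulrC [l * _]mulrC divfK ?gt_eqF // /l; lra.
have u1 : 1 < u by rewrite /u; lra.
(* Mirror image: a strategy of value above [l'] exists when p >= alpha, and [v] is the midpoint of c
   / l' and 1. *)
pose l' := (c + alpha) / 2; pose v := (1 + c / l') / 2.
have l'0 : 0 < l' by rewrite /l'; lra.
have l'1 : l' <= 1 by rewrite /l'; lra.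
have l'a : l' < alpha by rewrite /l'; lra.
have cl'1 : c / l' < 1 by rewrite ltr_pdivrMr // mul1r /l'; lra.
have cl'0 : 0 < c / l' by rewrite divr_gt0.
have l'v : c < l' * v.
  rewrite /v mulrA mulrDr mulr1 mulrC [l' * _]mulrC divfK ?gt_eqF // /l'; lra.
have v01 : 0 < v < 1 by apply/andP; rewrite /v; split; lra.
have [v0 v1] := andP v01.
pose a := c * ln u - ln (1 + (u - 1) * l); pose a' := c * ln v - ln (1 + (v - 1) * l').
have a_gt0 : 0 < a.
  apply: chernoff_rate_gt0 => //; first by lra.
    by rewrite ltr_pwDl // mulr_ge0 ?(ltW l0) // subr_ge0 ltW.
  by rewrite pmulr_rlt0 ?subr_gt0 // subr_lt0.
have a'_gt0 : 0 < a'.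
  apply: chernoff_rate_gt0 => //.
    have : 0 <= (1 - v) * (1 - l') by rewrite mulr_ge0 ?subr_ge0 // ltW.
    by move=> ?; lra.
  by rewrite nmulr_rlt0 ?subr_lt0 // subr_gt0.
have ln2_gt0 : 0 < ln 2 :> R by rewrite ln_gt0 // ltr1n.
have lnu_gt0 : 0 < ln u by rewrite ln_gt0.
(* [C1] gives a n >= E + ln u, since eps <= 1/2 means E >= ln 2, so that E / ln 2 >= 1 absorbs the
   rounding factor [u]; [C2] gives a' n >= E. *)
pose C1 := (1 + ln u / ln 2) / a; pose C2 := a'^-1.
have C1_gt0 : 0 < C1
  by rewrite divr_gt0 // ltr_pwDl // divr_ge0 // ?(ltW lnu_gt0) ?(ltW ln2_gt0).
have C2_gt0 : 0 < C2 by rewrite invr_gt0.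
exists q; split=> //; first by rewrite -(@ltr0q R).
exists (C1 + C2); split; first exact: addr_gt0.
move=> eps eps0 eps2 n; set E := ln eps^-1 => nE r BY BX P0 P1 ver.
have E2 : ln 2 <= E.
  by rewrite ler_ln ?posrE ?invr_gt0 // -[2]invrK lef_pV2 ?posrE ?invr_gt0.
have E0 : 0 <= E by apply: le_trans E2; exact: ltW.
have epsE : eps = expR (- E) by rewrite /E lnV ?posrE // opprK lnK.
have tail : u * expR (- a * n%:R) <= eps.
  rewrite -{1}(lnK (lt_trans ltr01 u1 : u \is Num.pos)) epsE -expRD ler_expR.
  have h1 : C1 * E <= n%:R.
    by apply: le_trans nE; rewrite ler_wpM2r // lerDl ltW.
  have h2 : a * (C1 * E) <= a * n%:R by rewrite ler_pM2l.
  have h3 : a * (C1 * E) = E + ln u * (E / ln 2).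
    by rewrite /C1; field; rewrite !gt_eqF.
  have h4 : ln u <= ln u * (E / ln 2)
    by rewrite ler_peMr ?(ltW lnu_gt0) // ler_pdivlMr // mul1r.
  lra.
have tail' : expR (- a' * n%:R) <= eps.
  rewrite epsE ler_expR mulNr lerN2 mulrC -ler_pdivrMr // mulrC.
  by apply: le_trans nE; rewrite ler_wpM2r // lerDr ltW.
have [k kE] : exists k : nat, Num.floor (q * n%:R) = k%:Z.
  exists `|Num.floor (q * n%:R)|%N; rewrite gez0_abs // floor_ge0 mulr_ge0 //.
  by rewrite -(@ler0q R) ltW.
have cn : c * n%:R = ratr (q * n%:R) by rewrite rmorphM /= ratr_nat.
have kn : k%:R <= c * n%:R.
  rewrite cn -(ratr_nat R k) ler_rat; have := floor_le (q * n%:R).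
  by rewrite kE.
have kn1 : c * n%:R - 1 <= k%:R.
  rewrite lerBlDr cn -(ratr_nat R k) -(rmorph1 (@ratr R)) -rmorphD ler_rat ltW //.
  by have := floorD1_gt (q * n%:R); rewrite kE intrD.
rewrite kE pval_nE; split=> [ap|pb].
- have [X sX lX] : exists2 X, is_strategy X & l' < complex.Re (hs P1 X).
    have [hS|/sup_out] := pselect (has_sup [set complex.Re
      (hs P1 X) | X in [set X | @strategy R BY BX r X]]%classic).
      have al0 : 0 < alpha - l' by rewrite subr_gt0.
      have [_ [X /strategyP sX <-] h] := sup_adherent al0 hS.
      by exists X => //; move: ap; rewrite /pval; lra.
    (* Without a genuine supremum [sup] would default to 0, contradicting alpha > 0. *)
    by move=> s0; move: ap; rewrite /pval s0; lra.
  set f := fun X => \sum_(_ | _) _.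
  apply: (@le_trans _ _ (f (tens (@proj_pair BY BX n _ _) (fun=> X)))); last first.
    apply: ub_le_sup; last by eexists; first exact: is_strategy_tens sX.
    by exists 1 => _ [Y sY <-]; exact: parallel_value_le1.
  rewrite lerBlDr addrC -lerBlDr.
  apply: le_trans tail'; rewrite -(ler_pM2r (exprn_gt0 k v0)).
  apply: le_trans (chernoff_lower v01 l'1 kn).
  exact: completeness_bound (ltW lX).
- set S := (X in sup X).
  (* For degenerate registers there may be no strategy at all, and [sup set0 = 0]. *)
  have [->|/set0P Sn0] := eqVneq S set0; first by rewrite sup0 ltW.
  apply: ge_sup => // _ [X sX <-].
  have u0 : 0 < u by exact: lt_trans u1.
  apply: le_trans tail; rewrite -(ler_pM2r (exprn_gt0 k u0)).
  apply: le_trans (chernoff_upper u1 (ltW l0) kn1).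
  by apply: soundness_bound => //; [exact: ltW | exact: le_lt_trans bl].
Qed.
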